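(* Let $G$ be an orientable surface group of genus $n \geq 2$ or a non-orientable surface group of genus $n \geq 3$. Then the set of test elements of $G$ is dense in the profinite topology on $G$.
   Context: The orientable surface group of genus $n$ is $\langle x_1,\dots,x_{2n}\mid [x_1,x_2]\cdots[x_{2n-1},x_{2n}]\rangle$; the non-orientable surface group of genus $n$ is $\langle x_1,\dots,x_n\mid x_1^2\cdots x_n^2\rangle$. An element $g$ of a group $G$ is a test element of $G$ if every endomorphism $\varphi$ of $G$ with $\varphi(g)=g$ is an automorphism of $G$. The profinite topology on a group $G$ is the topology with basis $\{gN\mid g\in G,\ N\unlhd G,\ |G:N|<\infty\}$. *)

(* Defs.v *)
(* MathComp, with the classical and topological layers of MathComp-Analysis. *)
From HB Require Import structures.
From mathcomp Require Import all_boot.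
From mathcomp Require Import boolp classical_sets cardinality topology.

Set Implicit Arguments.
Unset Strict Implicit.
Unset Printing Implicit Defensive.

Import Algebra.

Local Open Scope classical_set_scope.
Local Open Scope quotient_scope.
Local Open Scope group_scope.

Record normal_subgroup (G : groupType) (N : set G) : Prop := NormalSubgroup {
  nsub1 : N 1;
  nsubM : forall x y, N x -> N y -> N (x * y);
  nsubV : forall x, N x -> N x^-1;
  nsubJ : forall x y, N x -> N (x ^ y) }.

Definition normal_closure (G : groupType) (R : set G) : set G :=
  smallest (@normal_subgroup G) R.

Lemma normal_closureP (G : groupType) (R : set G) :
  normal_subgroup (normal_closure R).
Proof.
split.
- by move=> A [/nsub1].
- by move=> x y Nx Ny A AR; apply: (nsubM AR.1); [exact: Nx|exact: Ny].
- by move=> x Nx A AR; apply: (nsubV AR.1); exact: Nx.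
- by move=> x y Nx A AR; apply: (nsubJ AR.1); exact: Nx.
Qed.

(** The letter [(x, true)] stands for the generator x and
    [(x, false)] for its inverse. *)

Section FreeGroup.
Variable X : choiceType.

Local Notation word := (seq (X * bool)).

Definition inv_letter (a : X * bool) : X * bool := (a.1, ~~ a.2).
Definition inv_word (w : word) : word := rev (map inv_letter w).

Inductive free_equiv : word -> word -> Prop :=
| free_equiv_cancel u v a : free_equiv (u ++ a :: inv_letter a :: v) (u ++ v)
| free_equiv_refl w : free_equiv w w
| free_equiv_sym v w : free_equiv v w -> free_equiv w v
| free_equiv_trans u v w : free_equiv u v -> free_equiv v w -> free_equiv u w.

Lemma inv_letterK : involutive inv_letter.
Proof. by case=> x b; rewrite /inv_letter /= negbK. Qed.

Lemma inv_wordK : involutive inv_word.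
Proof.
move=> w; rewrite /inv_word map_rev revK -map_comp -[RHS]map_id.
by apply: eq_map => a /=; rewrite inv_letterK.
Qed.

Lemma inv_word_cat u v : inv_word (u ++ v) = inv_word v ++ inv_word u.
Proof. by rewrite /inv_word map_cat rev_cat. Qed.

Lemma free_equiv_cat u u' v v' :
  free_equiv u u' -> free_equiv v v' -> free_equiv (u ++ v) (u' ++ v').
Proof.
move=> uu' vv'; apply: (@free_equiv_trans _ (u' ++ v)).
  move: uu'; clear vv'; elim=> {u u'} [u u' a|w|u w _ IH|u w w' _ IH1 _ IH2].
  - by rewrite -!catA /=; apply: free_equiv_cancel.
  - exact: free_equiv_refl.
  - exact: free_equiv_sym.
  - exact: free_equiv_trans IH1 IH2.
move: vv'; clear uu'; elim=> {v v'} [v v' a|w|v w _ IH|v w w' _ IH1 _ IH2].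
- by rewrite !catA; apply: free_equiv_cancel.
- exact: free_equiv_refl.
- exact: free_equiv_sym.
- exact: free_equiv_trans IH1 IH2.
Qed.

Lemma free_equiv_inv u v : free_equiv u v -> free_equiv (inv_word u) (inv_word v).
Proof.
elim=> {u v} [u v a|w|u w _ IH|u w w' _ IH1 _ IH2].
- rewrite -[a :: _]/([:: a; inv_letter a] ++ v) !inv_word_cat -catA.
  rewrite /inv_word /= /rev /= inv_letterK.
  exact: (free_equiv_cancel (inv_word v) (inv_word u) a).
- exact: free_equiv_refl.
- exact: free_equiv_sym.
- exact: free_equiv_trans IH1 IH2.
Qed.

Lemma free_equiv_mulV w : free_equiv (w ++ inv_word w) [::].
Proof.
elim: w => [|a w IH]; first exact: free_equiv_refl.
rewrite -cat1s inv_word_cat -!catA [w ++ _]catA.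
apply: free_equiv_trans (free_equiv_cancel [::] [::] a).
apply: (@free_equiv_cat [:: a] [:: a]); first exact: free_equiv_refl.
exact: (@free_equiv_cat _ [::] _ [:: inv_letter a] IH (free_equiv_refl _)).
Qed.

Definition free_equivb (u v : word) : bool := `[< free_equiv u v >].

Lemma free_equivb_equiv : equiv_class_of free_equivb.
Proof.
split=> [u|u v|v u w].
- exact/asboolP/free_equiv_refl.
- by apply/asboolP/asboolP; exact: free_equiv_sym.
- by move=> /asboolP uv /asboolP vw; apply/asboolP/(free_equiv_trans uv vw).
Qed.

Canonical free_equivb_rel := EquivRelPack free_equivb_equiv.

Definition free_group : Type := {eq_quot free_equivb}.
HB.instance Definition _ := Choice.on free_group.
HB.instance Definition _ := EqQuotient.on free_group.

Definition free_mul (x y : free_group) : free_group :=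
  \pi_free_group (repr x ++ repr y : word).
Definition free_inv (x : free_group) : free_group :=
  \pi_free_group (inv_word (repr x)).
Definition free_one : free_group := \pi_free_group ([::] : word).

Lemma free_piP (u v : word) :
  free_equiv u v <-> \pi_free_group u = \pi_free_group v.
Proof.
split=> [uv|/eqP]; first by apply/eqmodP/asboolP.
by move/eqP/eqmodP/asboolP.
Qed.

Lemma free_repr_pi (u : word) : free_equiv (repr (\pi_free_group u)) u.
Proof. by apply/free_piP; rewrite reprK. Qed.

Lemma free_pi_mul (u v : word) :
  free_mul (\pi u) (\pi v) = \pi_free_group (u ++ v : word).
Proof. by apply/free_piP/free_equiv_cat; exact: free_repr_pi. Qed.

Lemma free_pi_inv (u : word) : free_inv (\pi u) = \pi_free_group (inv_word u).
Proof. by apply/free_piP/free_equiv_inv; exact: free_repr_pi. Qed.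

Lemma free_mulA : associative free_mul.
Proof.
move=> x y z; rewrite -[x]reprK -[y]reprK -[z]reprK.
by rewrite !free_pi_mul catA.
Qed.

Lemma free_mul1 : left_id free_one free_mul.
Proof. by move=> x; rewrite -[x]reprK free_pi_mul. Qed.

Lemma free_mulr1 : right_id free_one free_mul.
Proof. by move=> x; rewrite -[x]reprK free_pi_mul cats0. Qed.

Lemma free_mulrV : right_inverse free_one free_inv free_mul.
Proof.
move=> x; rewrite -[x]reprK free_pi_inv free_pi_mul.
exact/free_piP/free_equiv_mulV.
Qed.

Lemma free_mulV : left_inverse free_one free_inv free_mul.
Proof.
move=> x; rewrite -[x]reprK free_pi_inv free_pi_mul.
apply/free_piP; rewrite -[X in free_equiv (_ ++ X)]inv_wordK.
exact: free_equiv_mulV.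
Qed.

HB.instance Definition _ := isGroup.Build free_group
  free_mulA free_mul1 free_mulr1 free_mulV free_mulrV.

Definition free_gen (x : X) : free_group := \pi_free_group ([:: (x, true)] : word).

End FreeGroup.

Section Presentation.
Variables (X : choiceType) (R : set (free_group X)).

Definition pres_equivb (x y : free_group X) : bool :=
  `[< normal_closure R (x^-1 * y) >].

Let N := normal_closureP R.

Lemma pres_equivb_equiv : equiv_class_of pres_equivb.
Proof.
split=> [x|x y|y x z].
- by apply/asboolP; rewrite mulVg; exact: nsub1 N.
- by apply/asboolP/asboolP => /(nsubV N); rewrite invgM invgK.
- move=> /asboolP xy /asboolP yz; apply/asboolP.
  by have := nsubM N xy yz; rewrite mulgA mulgK.
Qed.

Canonical pres_equivb_rel := EquivRelPack pres_equivb_equiv.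

Definition presented_group : Type := {eq_quot pres_equivb}.
HB.instance Definition _ := Choice.on presented_group.
HB.instance Definition _ := EqQuotient.on presented_group.

Definition pres_mul (x y : presented_group) : presented_group :=
  \pi_presented_group (repr x * repr y).
Definition pres_inv (x : presented_group) : presented_group :=
  \pi_presented_group (repr x)^-1.
Definition pres_one : presented_group := \pi_presented_group 1.

Lemma pres_piP (x y : free_group X) :
  normal_closure R (x^-1 * y) <->
  \pi_presented_group x = \pi_presented_group y.
Proof.
split=> [xy|]; first by apply/eqmodP/asboolP.
by move/eqmodP/asboolP.
Qed.

Lemma pres_repr_pi (x : free_group X) :
  normal_closure R ((repr (\pi_presented_group x))^-1 * x).
Proof. by apply/pres_piP; rewrite reprK. Qed.

Lemma pres_pi_mul (x y : free_group X) :
  pres_mul (\pi x) (\pi y) = \pi_presented_group (x * y).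
Proof.
apply/pres_piP; have hx := nsubJ N y (pres_repr_pi x).
have := nsubM N (pres_repr_pi y) hx.
by rewrite /conjg invgM !mulgA mulgK.
Qed.

Lemma pres_pi_inv (x : free_group X) :
  pres_inv (\pi x) = \pi_presented_group x^-1.
Proof.
apply/pres_piP; have := nsubJ N x^-1 (nsubV N (pres_repr_pi x)).
by rewrite /conjg !invgM !invgK !mulgA mulgV mul1g.
Qed.

Lemma pres_mulA : associative pres_mul.
Proof.
move=> x y z; rewrite -[x]reprK -[y]reprK -[z]reprK.
by rewrite !pres_pi_mul mulgA.
Qed.

Lemma pres_mul1 : left_id pres_one pres_mul.
Proof. by move=> x; rewrite -[x]reprK pres_pi_mul mul1g. Qed.

Lemma pres_mulr1 : right_id pres_one pres_mul.
Proof. by move=> x; rewrite -[x]reprK pres_pi_mul mulg1. Qed.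

Lemma pres_mulV : left_inverse pres_one pres_inv pres_mul.
Proof. by move=> x; rewrite -[x]reprK pres_pi_inv pres_pi_mul mulVg. Qed.

Lemma pres_mulrV : right_inverse pres_one pres_inv pres_mul.
Proof. by move=> x; rewrite -[x]reprK pres_pi_inv pres_pi_mul mulgV. Qed.

HB.instance Definition _ := isGroup.Build presented_group
  pres_mulA pres_mul1 pres_mulr1 pres_mulV pres_mulrV.

End Presentation.

Definition isomorphic (G H : groupType) : Prop :=
  exists f : UMagmaMorphism.type G H, bijective f.

(** Generators are indexed from 0, so that the pair [x_{2i+1}, x_{2i+2}] of
    the usual 1-based presentation is indexed by [2i] and [2i+1], for i < n. *)

Definition ord_dbl (n : nat) (i : 'I_n) : 'I_n.*2 :=
  Ordinal (etrans (ltn_double i n) (ltn_ord i)).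
Definition ord_dblS (n : nat) (i : 'I_n) : 'I_n.*2 :=
  Ordinal (etrans (ltn_Sdouble i n) (ltn_ord i)).

Definition orientable_relator (n : nat) : free_group 'I_n.*2 :=
  \prod_(i < n) [~ free_gen (ord_dbl i), free_gen (ord_dblS i)].

Definition nonorientable_relator (n : nat) : free_group 'I_n :=
  \prod_(i < n) free_gen i ^+ 2.

Definition orientable_surface_group (n : nat) (G : groupType) : Prop :=
  isomorphic G (presented_group [set orientable_relator n]).

Definition nonorientable_surface_group (n : nat) (G : groupType) : Prop :=
  isomorphic G (presented_group [set nonorientable_relator n]).

Definition test_element (G : groupType) (g : G) : Prop :=
  forall phi : UMagmaMorphism.type G G, phi g = g -> bijective phi.

Section ProfiniteTopology.
Variable G : groupType.

Definition lcoset_set (g : G) (N : set G) : set G := [set g * x | x in N].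

Definition finite_index (N : set G) : Prop :=
  finite_set [set lcoset_set g N | g in [set: G]].

Definition profinite_base : set (set G) :=
  [set A | exists g N,
     [/\ normal_subgroup N, finite_index N & A = lcoset_set g N]].

(** [G] itself, equipped below with the profinite topology. *)
Definition profinite : Type := G.
HB.instance Definition _ := Choice.on profinite.

Lemma lcoset_setE g N : lcoset_set g N = [set x | N (g^-1 * x)].
Proof.
apply/seteqP; split=> [_ [x Nx <-]|x Nx] /=; first by rewrite mulKg.
by exists (g^-1 * x) => //; rewrite mulVKg.
Qed.

Lemma finite_indexI N M :
  finite_index N -> finite_index M -> finite_index (N `&` M).
Proof.
move=> fN fM; apply: sub_finite_set (finite_image2 (@setI G) fN fM).
move=> _ [g _ <-]; exists (lcoset_set g N); first by exists g.
by exists (lcoset_set g M); [exists g | rewrite !lcoset_setE].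
Qed.

Lemma normal_subgroupI (N M : set G) :
  normal_subgroup N -> normal_subgroup M -> normal_subgroup (N `&` M).
Proof.
move=> hN hM; split.
- by split; [exact: nsub1 hN|exact: nsub1 hM].
- by move=> x y [? ?] [? ?]; split; [apply: (nsubM hN)|apply: (nsubM hM)].
- by move=> x [? ?]; split; [apply: (nsubV hN)|apply: (nsubV hM)].
- by move=> x y [? ?]; split; [apply: (nsubJ hN)|apply: (nsubJ hM)].
Qed.

Lemma profinite_base_cover :
  \bigcup_(A in profinite_base) (A : set profinite) = [set: profinite].
Proof.
apply/seteqP; split=> // x _; exists setT => //; exists 1, setT; split=> //.
- apply: sub_finite_set (finite_set1 setT) => _ [g _ <-] /=.
  by rewrite lcoset_setE; apply/seteqP.
- by rewrite lcoset_setE; apply/seteqP.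
Qed.

Lemma profinite_base_join (A B : set G) (t : profinite) :
  profinite_base A -> profinite_base B -> A t -> B t ->
  exists C : set G, [/\ profinite_base C, C t & C `<=` A `&` B].
Proof.
move=> [g [N [nN fN ->]]] [h [M [nM fM ->]]].
rewrite !lcoset_setE /= => Nt Mt.
exists (lcoset_set t (N `&` M)); split.
- exists t, (N `&` M); split=> //; first exact: normal_subgroupI.
  exact: finite_indexI.
- rewrite lcoset_setE /= mulVg.
  by split; [exact: nsub1 nN|exact: nsub1 nM].
- rewrite lcoset_setE => x /= [Nx Mx]; split.
    by have := nsubM nN Nt Nx; rewrite mulgA mulgK.
  by have := nsubM nM Mt Mx; rewrite mulgA mulgK.
Qed.

HB.instance Definition _ := isBaseTopological.Build profinite
  profinite_base_cover profinite_base_join.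

End ProfiniteTopology.

(* Main.v *)
Require Import Defs.
From HB Require Import structures.
From mathcomp Require Import all_boot fingroup perm all_algebra.
From mathcomp Require Import generic_quotient.
From mathcomp Require Import ring zify.
From mathcomp Require Import boolp classical_sets cardinality topology.
From mathcomp Require cyclic.

(** The argument reduces everything to finite quotients and to a counting
    argument on cosets; no geometry of surfaces is used.  Write x_k for the
    generators, r for the relator, and K for the image of an endomorphism phi
    that fixes an element h.

    Choice of h.  Let gN be a basic open set, m an exponent for G/N and p > 2 a
    prime not dividing m.  With s divisible by p^2 and congruent to 1 modulo m,
    h = g^s h0^m lies in gN, while h0^m is all that remains of h in a quotient
    of exponent p.  The element h0 is a product of commutators of generators
    (and of x_0^p in the non-orientable case).  Suppose a homomorphism A from G
    to F_p which comes from Hom(G, Z) satisfies A o phi = 0.  For every B such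
    that (A, B) lifts to a homomorphism f into the Heisenberg group over F_p,
    the image of f o phi is abelian of exponent p, so f(h) = f(phi(h)) is
    trivial, whereas f(h) is a nonzero multiple of the value at (A, B) of the
    alternating form given by h0.  In the orientable case the pairs (A, B) that
    lift are those with zero cup product, so A is an eigenvector of an operator
    attached to h0; h0 is built from a matrix without eigenvalues in F_p
    (orientable_base_test).
    In the non-orientable case every pair lifts, and a chain of commutators
    together with x_0^p forces A = 0 (nonorientable_base_test).  Hence phi is
    injective on H_1(G; Z) modulo torsion.

    Surjectivity.  The coset count of image_cover comes from parallel
    transport: a labelling of the edges of the Schreier graph of K by a group U
    extends to paths.  In a free group, phi(r) is a product of conjugates of r,
    and transporting along phi(r) and along r gives a finitely supported
    function v on the cosets of K, with values in F_2.  Every generator occurs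
    twice in r, which makes v invariant under G.  If v = 0, then any two classes
    in Hom(G, Z), which all factor through K, have even cup product; this is
    false for surface groups.  So v = 1 everywhere and K has finite index.  A
    count of cocycles on the Schreier graph, which bounds from below the first
    Betti number of a subgroup of given index, then shows that the index is 1
    (image_full).

    Injectivity.  A surface group satisfies a relation t a t^-1 = P a^(+-1) Q
    with P and Q in the other generators u_j.  An element outside the kernel of
    the map to Z given by t is detected by a cyclic quotient; the others are
    conjugate to words in a and in the t^i u_j t^-i with i >= 0.  These behave
    as free generators which t permutes by a shift, except for the rewriting of
    a, and making the shift periodic yields finite quotients that detect every
    nontrivial element (hnn_residually_finite).  Finitely generated residually
    finite groups are Hopfian (hopfian). *)

Set Implicit Arguments.
Unset Strict Implicit.
Unset Printing Implicit Defensive.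

Import Algebra GRing.Theory.
Local Open Scope classical_set_scope.
Local Open Scope quotient_scope.
Local Open Scope group_scope.

(** * Homomorphisms out of free and presented groups *)

Section WordEval.
Variables (X : choiceType) (H : groupType) (y : X -> H).

Definition word_eval (w : seq (X * bool)) : H :=
  \prod_(a <- w) (if a.2 then y a.1 else (y a.1)^-1).

Lemma word_eval_cat u v : word_eval (u ++ v) = word_eval u * word_eval v.
Proof. exact: big_cat. Qed.

Lemma word_eval_equiv u v : free_equiv u v -> word_eval u = word_eval v.
Proof.
elim=> {u v} [u v [a b]|//|u v _ -> //|u v w _ -> //].
rewrite !word_eval_cat; congr (_ * _); rewrite /word_eval !big_cons /=.
by case: b => /=; rewrite ?mulKg ?mulVKg.
Qed.

Definition lift (z : free_group X) : H := word_eval (repr z).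

Lemma lift_pi w : lift (\pi_(free_group X) w) = word_eval w.
Proof. exact/word_eval_equiv/free_repr_pi. Qed.

Lemma liftM : {morph lift : a b / a * b}.
Proof.
move=> a b; rewrite -[a]reprK -[b]reprK.
rewrite [_ * _](free_pi_mul (repr a) (repr b)).
by rewrite !lift_pi word_eval_cat.
Qed.

Lemma lift1 : lift 1 = 1.
Proof. by apply: (@mulIg _ (lift 1)); rewrite -liftM !mul1g. Qed.

HB.instance Definition _ := isMultiplicative.Build _ _ lift liftM.
HB.instance Definition _ := Multiplicative_isUMagmaMorphism.Build _ _ lift lift1.

Lemma lift_gen k : lift (free_gen k) = y k.
Proof. by rewrite lift_pi /word_eval big_seq1. Qed.

End WordEval.

(** Induction on elements rather than on words; all identities between two
    homomorphisms out of a free group are checked with it. *)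
Lemma free_ind (X : choiceType) (P : free_group X -> Prop) :
  P 1 -> (forall k, P (free_gen k)) -> (forall a b, P a -> P b -> P (a * b)) ->
  (forall a, P a -> P a^-1) -> forall z, P z.
Proof.
move=> P1 Pgen PM PV z; rewrite -[z]reprK.
elim: (repr z) => [//|[k b] w IH].
have -> : \pi_(free_group X) ((k, b) :: w) =
    \pi_(free_group X) [:: (k, b)] * \pi_(free_group X) w.
  by rewrite [RHS](free_pi_mul [:: (k, b)] w).
apply: PM => //; case: b; first exact: Pgen.
have -> : \pi_(free_group X) [:: (k, false)] = (free_gen k)^-1.
  by rewrite [RHS](free_pi_inv [:: (k, true)]).
exact/PV/Pgen.
Qed.

Lemma gmulf_lift (X : choiceType) (H H' : groupType) (y : X -> H)
    (f : UMagmaMorphism.type H H') z :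
  f (lift y z) = lift (f \o y) z.
Proof.
elim/free_ind: z => [|k|a b IHa IHb|a IHa]; rewrite ?lift1 ?gmulf1 ?lift_gen //.
  by rewrite !gmulfM /= IHa IHb.
by rewrite !gmulfV /= IHa.
Qed.

(** Stated for a family in G itself, so that no later statement has to be
    transported along an isomorphism. *)
Definition presents (X : choiceType) (r : free_group X) (G : groupType)
    (x : X -> G) : Prop :=
  (forall g, exists z, lift x z = g) /\
  (forall z, lift x z = 1 <-> normal_closure [set r] z).

Lemma isomorphic_presents (X : choiceType) (r : free_group X) (G : groupType) :
  isomorphic G (presented_group [set r]) -> exists x : X -> G, presents r x.
Proof.
pose P := presented_group [set r].
move=> [f [g gf fg]].
have piM (a b : free_group X) : \pi_P (a * b) = \pi_P a * \pi_P b.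
  exact: esym (pres_pi_mul _ a b).
have pi1 : \pi_P (1 : free_group X) = 1 by [].
have piV (a : free_group X) : \pi_P a^-1 = (\pi_P a)^-1.
  exact: esym (pres_pi_inv _ a).
pose x k := g (\pi_P (free_gen k)).
have fx z : f (lift x z) = \pi_P z.
  elim/free_ind: z => [|k|a b IHa IHb|a IHa]; rewrite ?lift1 ?gmulf1 ?lift_gen ?pi1 //.
  - exact: fg.
  - by rewrite !gmulfM /= IHa IHb piM.
  - by rewrite !gmulfV /= IHa piV.
exists x; split=> [h|z].
  by exists (repr (f h)); apply: (can_inj gf); rewrite fx reprK.
split=> [z1|Nz].
  have : \pi_P (1 : free_group X) = \pi_P z by rewrite -!fx z1 gmulf1.
  by move/(pres_piP [set r]); rewrite invg1 mul1g.
apply: (can_inj gf); rewrite fx gmulf1 -pi1; apply/esym/(pres_piP [set r]).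
by rewrite invg1 mul1g.
Qed.

Lemma presents_rel (X : choiceType) (r : free_group X) (G : groupType)
  (x : X -> G) : presents r x -> lift x r = 1.
Proof. by move=> [_ /(_ r) [_ ->]] // A [_]; exact. Qed.

Lemma ker_normal (G H : groupType) (f : UMagmaMorphism.type G H) :
  normal_subgroup [set g | f g = 1].
Proof.
split=> /= [|a b fa fb|a fa|a b fa].
- exact: gmulf1.
- by rewrite gmulfM fa fb mulg1.
- by rewrite gmulfV fa invg1.
- by rewrite gmulfJ fa conj1g.
Qed.

(** The universal property of a presentation, in the form used below: f
    intertwines the evaluations of every element of the free group. *)
Lemma presents_hom (X : choiceType) (r : free_group X) (G H : groupType)
    (x : X -> G) (y : X -> H) : presents r x -> lift y r = 1 ->
  exists f : UMagmaMorphism.type G H, forall z, f (lift x z) = lift y z.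
Proof.
move=> [sur ker] yr.
have xy z : lift x z = 1 -> lift y z = 1.
  move/ker; move/(_ [set g | lift y g = 1]); apply.
  split; first exact: (ker_normal (lift y)).
  by move=> _ ->.
have xyE z z' : lift x z = lift x z' -> lift y z = lift y z'.
  move=> e; apply/divg1_eq; rewrite -gmulfF; apply: xy.
  by rewrite gmulfF /= e mulgV.
pose s g := projT1 (cid (sur g)).
have sE g : lift x (s g) = g by rewrite /s; case: cid.
pose f g := lift y (s g).
have fM : {morph f : a b / a * b}.
  by move=> a b; rewrite /f -gmulfM; apply: xyE; rewrite gmulfM /= !sE.
have f1 : f 1 = 1.
  by rewrite /f; apply: xy; rewrite sE.
pose m1 := isMultiplicative.Build _ _ f fM.
pose m2 := Multiplicative_isUMagmaMorphism.Build _ _ f f1.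
pose F : UMagmaMorphism.type G H := HB.pack f m1 m2.
by exists F => z; rewrite /F /= /f; apply: xyE; rewrite sE.
Qed.
(** * Heisenberg groups *)

Section Heisenberg.
Variable R : comNzRingType.

(** Upper unitriangular 3 x 3 matrices; hx and hy are the entries next to the
    diagonal and hz is the corner.  A homomorphism into this group is a pair of
    additive maps together with a trivialization of their cup product. *)
Definition heis : Type := (R * R * R)%type.
HB.instance Definition _ := Choice.on heis.

Definition hx (u : heis) : R := u.1.1.
Definition hy (u : heis) : R := u.1.2.
Definition hz (u : heis) : R := u.2.

Lemma heis_ext u v : hx u = hx v -> hy u = hy v -> hz u = hz v -> u = v.
Proof. by case: u v => [[a b] c] [[a' b'] c']; rewrite /hx /hy /hz /= => -> -> ->. Qed.

Definition heis_mul (u v : heis) : heis :=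
  (hx u + hx v, hy u + hy v, hz u + hz v + hx u * hy v)%R.
Definition heis_inv (u : heis) : heis :=
  (- hx u, - hy u, - hz u + hx u * hy u)%R.
Definition heis_one : heis := (0, 0, 0)%R.

Lemma heis_mulA : associative heis_mul.
Proof. by move=> u v w; apply: heis_ext; rewrite /heis_mul /hx /hy /hz /=; ring. Qed.
Lemma heis_mul1 : left_id heis_one heis_mul.
Proof. by move=> u; apply: heis_ext; rewrite /heis_mul /hx /hy /hz /=; ring. Qed.
Lemma heis_mulr1 : right_id heis_one heis_mul.
Proof. by move=> u; apply: heis_ext; rewrite /heis_mul /hx /hy /hz /=; ring. Qed.
Lemma heis_mulV : left_inverse heis_one heis_inv heis_mul.
Proof. by move=> u; apply: heis_ext; rewrite /heis_mul /hx /hy /hz /=; ring. Qed.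
Lemma heis_mulrV : right_inverse heis_one heis_inv heis_mul.
Proof. by move=> u; apply: heis_ext; rewrite /heis_mul /hx /hy /hz /=; ring. Qed.

HB.instance Definition _ := isGroup.Build heis
  heis_mulA heis_mul1 heis_mulr1 heis_mulV heis_mulrV.

Lemma hxM u v : hx (u * v) = (hx u + hx v)%R. Proof. by []. Qed.
Lemma hyM u v : hy (u * v) = (hy u + hy v)%R. Proof. by []. Qed.
Lemma hzM u v : hz (u * v) = (hz u + hz v + hx u * hy v)%R. Proof. by []. Qed.
Lemma hxV u : hx u^-1 = (- hx u)%R. Proof. by []. Qed.
Lemma hyV u : hy u^-1 = (- hy u)%R. Proof. by []. Qed.
Lemma hzV u : hz u^-1 = (- hz u + hx u * hy u)%R. Proof. by []. Qed.
Lemma hx1 : hx 1 = 0%R. Proof. by []. Qed.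
Lemma hy1 : hy 1 = 0%R. Proof. by []. Qed.

Definition hcen (c : R) : heis := (0, 0, c)%R.

Lemma hcenM c d : hcen (c + d)%R = hcen c * hcen d.
Proof. by apply: heis_ext; rewrite ?hxM ?hyM ?hzM /hx /hy /hz /=; ring. Qed.

Lemma hcen0 : hcen 0%R = 1. Proof. by []. Qed.

Lemma hcen_sum I (s : seq I) (P : pred I) (F : I -> R) :
  hcen (\sum_(i <- s | P i) F i)%R = \prod_(i <- s | P i) hcen (F i).
Proof. exact: (big_morph hcen hcenM hcen0). Qed.

Lemma hcenX c n : hcen c ^+ n = hcen (c *+ n)%R.
Proof.
by elim: n => [|n IH]; rewrite ?expgS ?IH -?hcenM ?mulr0n ?mulrS.
Qed.

Lemma hcenC c u : commute (hcen c) u.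
Proof. by apply: heis_ext; rewrite ?hxM ?hyM ?hzM /hx /hy /hz /=; ring. Qed.

(** The commutator form is the standard symplectic form, which is how an
    alternating form on Hom(G, R) is read off a product of commutators. *)
Lemma heis_comm u v : [~ u, v] = hcen (hx u * hy v - hx v * hy u)%R.
Proof.
apply: heis_ext; rewrite commgEl conjgE ?(hxM, hyM, hzM, hxV, hyV, hzV);
  by rewrite /hx /hy /hz /=; ring.
Qed.

Lemma hxX u n : hx (u ^+ n) = (hx u *+ n)%R.
Proof. by elim: n => [|n IH]; rewrite ?mulr0n // expgS hxM IH mulrS. Qed.

Lemma hyX u n : hy (u ^+ n) = (hy u *+ n)%R.
Proof. by elim: n => [|n IH]; rewrite ?mulr0n // expgS hyM IH mulrS. Qed.

Lemma hzX u n : hz (u ^+ n) = (hz u *+ n + (hx u * hy u) *+ 'C(n, 2))%R.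
Proof.
elim: n => [|n IH]; first by rewrite !mulr0n addr0.
by rewrite expgS hzM IH hyX binS bin1 mulrS mulrnDr mulrnAr; ring.
Qed.

Lemma hx_prod I (s : seq I) (P : pred I) (F : I -> heis) :
  hx (\prod_(i <- s | P i) F i) = (\sum_(i <- s | P i) hx (F i))%R.
Proof. exact: (big_morph hx hxM hx1). Qed.

Lemma hy_prod I (s : seq I) (P : pred I) (F : I -> heis) :
  hy (\prod_(i <- s | P i) F i) = (\sum_(i <- s | P i) hy (F i))%R.
Proof. exact: (big_morph hy hyM hy1). Qed.

Lemma hx_morph (G : groupType) (f : UMagmaMorphism.type G heis) :
  {morph hx \o f : a b / a * b >-> (a + b)%R}.
Proof. by move=> a b /=; rewrite gmulfM. Qed.

End Heisenberg.

(** * Parallel transport along words *)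

Section Wreath.
Variables (G U : groupType).

(** The wreath product of U by the right regular action of G.  Labels on the
    edges of the Cayley graph of G become elements of this group, so that the
    transport along a word is an ordinary product. *)
Definition wreath : Type := (G * (G -> U))%type.
HB.instance Definition _ := gen_eqMixin wreath.
HB.instance Definition _ := gen_choiceMixin wreath.

Definition wreath_mul (p q : wreath) : wreath :=
  (p.1 * q.1, fun g => p.2 g * q.2 (g * p.1)).
Definition wreath_one : wreath := (1, fun=> 1).
Definition wreath_inv (p : wreath) : wreath :=
  (p.1^-1, fun g => (p.2 (g * p.1^-1))^-1).

Lemma wreath_ext (p q : wreath) : p.1 = q.1 -> p.2 =1 q.2 -> p = q.
Proof. by case: p q => [a f] [b h] /= -> /funext ->. Qed.

Lemma wreath_mulA : associative wreath_mul.
Proof. by move=> p q r; apply: wreath_ext => [|g] /=; rewrite !mulgA. Qed.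
Lemma wreath_mul1 : left_id wreath_one wreath_mul.
Proof. by move=> p; apply: wreath_ext => [|g] /=; rewrite ?mulg1 mul1g. Qed.
Lemma wreath_mulr1 : right_id wreath_one wreath_mul.
Proof. by move=> p; apply: wreath_ext => [|g] /=; rewrite mulg1. Qed.
Lemma wreath_mulV : left_inverse wreath_one wreath_inv wreath_mul.
Proof. by move=> p; apply: wreath_ext => [|g] /=; rewrite mulVg. Qed.
Lemma wreath_mulrV : right_inverse wreath_one wreath_inv wreath_mul.
Proof. by move=> p; apply: wreath_ext => [|g] /=; rewrite ?mulgK mulgV. Qed.

HB.instance Definition _ := isGroup.Build wreath
  wreath_mulA wreath_mul1 wreath_mulr1 wreath_mulV wreath_mulrV.

End Wreath.

Section Transport.
Variables (X : choiceType) (G U : groupType) (x : X -> G) (l : G -> X -> U).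

Definition wgen (k : X) : wreath G U := (x k, l^~ k).

(** The product of the labels met along the path that starts at the vertex g
    and reads z, an edge g -> g x_k having the label l g k. *)
Definition transport (g : G) (z : free_group X) : U := (lift wgen z).2 g.

Lemma wgen_fst z : (lift wgen z).1 = lift x z.
Proof.
elim/free_ind: z => [|k|a b IHa IHb|a IHa]; rewrite ?lift1 ?lift_gen //.
  by rewrite !gmulfM /= IHa IHb.
by rewrite !gmulfV /= IHa.
Qed.

Lemma transport1 g : transport g 1 = 1.
Proof. by rewrite /transport lift1. Qed.

Lemma transport_gen g k : transport g (free_gen k) = l g k.
Proof. by rewrite /transport lift_gen. Qed.

Lemma transportM g a b :
  transport g (a * b) = transport g a * transport (g * lift x a) b.
Proof. by rewrite /transport gmulfM /= wgen_fst. Qed.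

Lemma transportV g a :
  transport g a^-1 = (transport (g * (lift x a)^-1) a)^-1.
Proof. by rewrite /transport gmulfV /= wgen_fst. Qed.

End Transport.

(** Labels which are invariant under a set K of left translations live on the
    Schreier graph of K. *)
Lemma transport_invariant (X : choiceType) (G U : groupType) (x : X -> G)
    (l : G -> X -> U) (K : set G) :
  (forall k g i, K k -> l (k * g) i = l g i) ->
  forall k g z, K k -> transport x l (k * g) z = transport x l g z.
Proof.
move=> lK k g z Kk; elim/free_ind: z g => [|i|a b IHa IHb|a IHa] g.
- by rewrite !transport1.
- by rewrite !transport_gen lK.
- by rewrite !transportM IHa -mulgA IHb.
- by rewrite !transportV -mulgA IHa.
Qed.
(** * Images of endomorphisms have finite index *)

Lemma opprF2 (c : 'F_2) : (- c = c)%R.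
Proof. by apply/val_inj; case: c => [[|[|]]]. Qed.

(** An element z of the normal closure of r is a product of conjugates of r or
    its inverse; s lists the conjugating elements.  When the transport along r
    is central of exponent 2, only the position of each conjugate matters, and
    neither its order nor its sign. *)
Lemma transport_normal_closure (X : choiceType) (G : groupType) (x : X -> G)
    (r : free_group X) : lift x r = 1 ->
  forall z, normal_closure [set r] z -> exists s : seq G,
  forall (l : G -> X -> heis 'F_2) (f : G -> 'F_2),
    (forall g, transport x l g r = hcen (f g)) ->
    forall g, transport x l g z = hcen (\sum_(c <- s) f (g * c)%g)%R.
Proof.
move=> xr z Nz.
(* The elements that satisfy the claim form a normal subgroup containing r. *)
pose S : set (free_group X) := [set z | lift x z = 1 /\ exists s : seq G,
  forall (l : G -> X -> heis 'F_2) (f : G -> 'F_2),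
    (forall g, transport x l g r = hcen (f g)) ->
    forall g, transport x l g z = hcen (\sum_(c <- s) f (g * c)%g)%R].
suff [] : S z by [].
apply: (Nz S); split; last first.
  by move=> _ ->; split=> //; exists [:: 1] => l f lf g; rewrite big_seq1 mulg1.
split=> [|a b [a1 [s sP]] [b1 [t tP]]|a [a1 [s sP]]|a u [a1 [s sP]]].
- by split; [exact: lift1|exists [::] => l f _ g; rewrite big_nil transport1].
- split; first by rewrite liftM a1 b1 mulg1.
  exists (s ++ t) => l f lf g.
  by rewrite transportM a1 mulg1 (sP l f) // (tP l f) // big_cat hcenM.
- split; first by rewrite gmulfV /= a1 invg1.
  exists s => l f lf g; rewrite transportV a1 invg1 mulg1 (sP l f) //.
  by apply: mulg1_eq; rewrite -hcenM -[X in (X + _)%R]opprF2 addNr.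
- split; first by rewrite gmulfJ /= a1 conj1g.
  exists [seq (lift x u)^-1 * c | c <- s] => l f lf g.
  rewrite conjgE !transportM transportV a1 gmulfV /= mulg1 (sP l f) //.
  rewrite hcenC mulKg big_map; congr hcen.
  by apply: eq_bigr => c _; rewrite mulgA.
Qed.

(** Lifting phi to the free group by zs, the words zs k are loops at the coset
    of 1 in the Schreier graph of the image of phi, so transport along them is
    multiplicative. *)
Lemma transport_endo (X : choiceType) (G U : groupType) (x : X -> G)
    (phi : UMagmaMorphism.type G G) (zs : X -> free_group X) (l : G -> X -> U) :
  (forall k, lift x (zs k) = phi (x k)) ->
  (forall a g k, l (phi a * g) k = l g k) ->
  forall z, transport x l 1 (lift zs z) = lift (fun k => transport x l 1 (zs k)) z.
Proof.
move=> zsE linv.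
have lzs z : lift x (lift zs z) = phi (lift x z).
  by rewrite !gmulf_lift; congr lift; apply/funext => k /=.
have tinv a g z : transport x l (phi a * g) z = transport x l g z.
  apply: (@transport_invariant _ _ _ x l (range phi)); last by exists a.
  by move=> _ h k [b _ <-].
elim/free_ind => [|k|a b IHa IHb|a IHa].
- by rewrite !lift1 transport1.
- by rewrite !lift_gen.
- rewrite [in LHS]liftM transportM liftM -IHa -IHb lzs mul1g.
  by rewrite -[phi _]mulg1 tinv.
- rewrite gmulfV /= transportV gmulfV /= -IHa lzs mul1g -gmulfV.
  by rewrite -[phi _]mulg1 tinv.
Qed.

(** Comparing the values of T decides whether two elements lie in the same right
    coset of the image. *)
Lemma coset_rep (G : groupType) (phi : UMagmaMorphism.type G G) :
  exists T : G -> G, (forall a c, T (phi a * c) = T c) /\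
                     (forall c, exists a, T c = phi a * c).
Proof.
pose P c : set G := [set d | exists a, d = phi a * c].
exists (fun c => xget 1 (P c)); split=> [a c|c].
  congr xget; apply/seteqP; split=> d [b ->] /=.
    by exists (b * a); rewrite gmulfM mulgA.
  by exists (b * a^-1); rewrite gmulfM gmulfV -!mulgA mulKg.
apply: (@xgetPex _ 1 (P c)); exists c; exists 1.
by rewrite gmulf1 mul1g.
Qed.

(** An additive map that kills the kernel of phi induces one on the image; al
    extends the latter to all of G, equivariantly on each coset.  Its
    coboundary is a label on the Schreier graph whose transport around a loop
    that represents phi g is A g. *)
Lemma factor_through_image (G : groupType) (V : zmodType)
    (phi : UMagmaMorphism.type G G) (A : G -> V) :
  {morph A : a b / a * b >-> (a + b)%R} ->
  (forall g, phi g = 1 -> A g = 0%R) ->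
  exists al : G -> V, forall g c, al (phi g * c) = (A g + al c)%R.
Proof.
move=> AM Aker; have [T [Tinv Tc]] := coset_rep phi.
pose si c := projT1 (cid (Tc c)).
have siE c : T c = phi (si c) * c by rewrite /si; case: cid.
have A1 : A 1 = 0%R by apply: Aker; exact: gmulf1.
have AV g : A g^-1 = (- A g)%R.
  by apply/eqP; rewrite -addr_eq0 -AM mulVg A1.
exists (fun c => - A (si c))%R => g c.
suff -> : A (si c) = (A (si (phi g * c)%g) + A g)%R by rewrite opprD addrC addrNK.
apply/eqP; rewrite -AM -subr_eq0 -AV -AM; apply/eqP/Aker.
rewrite gmulfM gmulfV gmulfM; apply/eqP; rewrite mulg_eq1 invgK; apply/eqP.
by apply: (@mulIg _ c); rewrite -mulgA -!siE Tinv.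
Qed.
(** Each generator labels exactly two edges of the loop r, starting at p k and
    q k, and the elements p k / q k generate G.  The first condition says that
    the surface is closed.  The second one holds since p k / q k runs through
    generators of the fundamental group for the dual cell structure. *)
Definition quadratic (X : finType) (r : free_group X) (G : groupType)
    (x : X -> G) : Prop := exists p q : X -> G,
  (forall (l : G -> X -> 'F_2) g, transport x (fun h k => hcen (l h k)) g r =
      hcen (\sum_k (l (g * p k)%g k + l (g * q k)%g k))%R) /\
  (forall S : set G, S 1 -> (forall a b, S a -> S b -> S (a * b)) ->
     (forall a, S a -> S a^-1) -> (forall k, S (p k / q k)) -> forall g, S g).

(** The class of r pairs to 1 with the cup product of A and B; equivalently,
    (A, B) cannot be lifted to a homomorphism into the Heisenberg group. *)
Definition cup_nonzero (X : finType) (r : free_group X) (A B : X -> 'F_2) : Prop :=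
  forall y : X -> heis 'F_2,
    (forall k, hx (y k) = A k) -> (forall k, hy (y k) = B k) ->
    lift y r = hcen 1%R.

Lemma transport_central (X : choiceType) (G : groupType) (R : comNzRingType)
    (x : X -> G) (l : G -> X -> R) g z :
  transport x (fun h k => hcen (l h k)) g z =
  hcen (hz (transport x (fun h k => hcen (l h k)) g z)).
Proof.
elim/free_ind: z g => [|k|a b IHa IHb|a IHa] g.
- by rewrite transport1.
- by rewrite transport_gen.
- by rewrite transportM IHa IHb -hcenM.
- by rewrite transportV IHa; apply: heis_ext; rewrite ?hxV ?hyV ?oppr0.
Qed.

Lemma transport_const (X : choiceType) (G U : groupType) (x : X -> G)
    (y : X -> U) g z : transport x (fun=> y) g z = lift y z.
Proof.
elim/free_ind: z g => [|k|a b IHa IHb|a IHa] g.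
- by rewrite transport1 lift1.
- by rewrite transport_gen lift_gen.
- by rewrite transportM IHa IHb liftM.
- by rewrite transportV IHa gmulfV.
Qed.

Lemma addF2 (c : 'F_2) : (c + c = 0)%R.
Proof. by rewrite -[X in (X + _)%R]opprF2 addNr. Qed.

Section ImageCover.
Variables (X : finType) (r : free_group X) (G : groupType) (x : X -> G).
Hypotheses (rx : presents r x) (rquad : quadratic r x).
Variables (phi : UMagmaMorphism.type G G) (A B : G -> 'F_2).
Hypotheses (AM : {morph A : a b / a * b >-> (a + b)%R})
  (BM : {morph B : a b / a * b >-> (a + b)%R}).
Hypothesis AB1 : cup_nonzero r (A \o x) (B \o x).
Hypotheses (Aker : forall g, phi g = 1 -> A g = 0%R)
  (Bker : forall g, phi g = 1 -> B g = 0%R).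

(** The parity v c of the number of elements of s in the coset of c is the
    degree of phi over that coset.  Labels supported on a single edge show that
    v is G-invariant.  It cannot vanish: otherwise the transport along phi(r)
    would be trivial for the Heisenberg labels built from A and B, which
    contradicts their cup product. *)
Lemma image_cover : exists s : seq G, forall g,
  exists2 c, c \in s & exists a, g = phi a * c.
Proof.
have [T [Tinv Tc]] := coset_rep phi.
have [zs zsE] : exists zs : X -> free_group X, forall k, lift x (zs k) = phi (x k).
  by case: rx => sur _; have [zs ?] := choice (fun k => sur (phi (x k))); exists zs.
have xr := presents_rel rx.
have zr : normal_closure [set r] (lift zs r).
  case: rx => _ <-; rewrite gmulf_lift.
  have -> : lift x \o zs = phi \o x by apply/funext => k /=.
  by rewrite -gmulf_lift xr gmulf1.
have [s sP] := transport_normal_closure xr zr.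
pose v c : 'F_2 := (\sum_(d <- s) (T d == T c)%:R)%R.
have [p [q [rpq gen]]] := rquad.
have vinv g : forall c, v (c * g) = v c.
  apply: (gen [set g | forall c, v (c * g) = v c]) => [c|a b /= va vb c|a /= va c|k c].
  - by rewrite mulg1.
  - by rewrite mulgA vb va.
  - by rewrite -(va (c / a)) mulgVK.
  pose c' := c * p k.
  (* The label supported on the edge k issued from the coset of c'. *)
  pose l (g : G) j : 'F_2 := ((T g == T c') && (j == k))%:R%R.
  have := sP _ _ (rpq l) 1.
  rewrite (transport_endo zsE); last by move=> a h j; rewrite /l Tinv.
  under [X in lift X]eq_fun do rewrite transport_central.
  rewrite -(transport_const x _ 1) rpq.
  rewrite big1; last by move=> j _; rewrite addF2.
  move/(congr1 (@hz _)); rewrite /hz /= => /esym.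
  have Teq a b h : (T (a * h) == T (b * h)) = (T a == T b).
    apply/eqP/eqP => e.
      have [a1 a1E] := Tc (a * h); have [b1 b1E] := Tc (b * h).
      have : phi (b1^-1 * a1) * a = b.
        apply: (@mulIg _ h); rewrite gmulfM gmulfV -!mulgA -a1E e b1E.
        by rewrite mulKg.
      by move <-; rewrite Tinv.
    have [a1 a1E] := Tc a; have [b1 b1E] := Tc b.
    have <- : phi (b1^-1 * a1) * a = b.
      by rewrite gmulfM gmulfV -!mulgA -a1E e b1E mulKg.
    by rewrite -mulgA Tinv.
  under eq_bigr => d _.
    rewrite mul1g (bigD1 k) //= big1 => [|j /negbTE jk]; last first.
      by rewrite /l jk !andbF addr0.
    rewrite addr0 /l eqxx !andbT -{1}(mulgVK (p k) c') -{2}(mulgVK (q k) c') !Teq.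
    over.
  rewrite big_split /= => /eqP; rewrite addr_eq0 opprF2 => /eqP.
  by rewrite /c' mulgK /v mulgA => ->.
(* A sum over s of a function of cosets only depends on v. *)
have sE f : (forall a c, f (phi a * c) = f c) ->
    (\sum_(c <- s) f c = \sum_(t <- undup [seq T c | c <- s])
       (\sum_(c <- s) (T c == t)%:R) * f t :> 'F_2)%R.
  move=> fT; under [RHS]eq_bigr do rewrite mulr_suml.
  rewrite exchange_big /=; apply: eq_big_seq => c cs.
  have Tcs : T c \in undup [seq T c | c <- s] by rewrite mem_undup map_f.
  rewrite (bigD1_seq (T c)) ?undup_uniq //= eqxx mul1r big1 => [|t /negbTE tc].
    by rewrite addr0; have [a ->] := Tc c; rewrite fT.
  by rewrite eq_sym tc mul0r.
have [v1|v1] := eqVneq (v 1) 0%R; last first.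
  exists s => g.
  have : v g != 0%R by rewrite -[g]mul1g vinv.
  have [/hasP [d ds /eqP Tdg] _|/hasPn s0] := boolP (has (fun d => T d == T g) s).
    have [a1 a1E] := Tc d; have [b1 b1E] := Tc g.
    exists d => //; exists (b1^-1 * a1).
    by rewrite gmulfM gmulfV -mulgA -a1E Tdg b1E mulKg.
  rewrite /v big_seq big1 ?eqxx // => d /s0.
  by move=> /negbTE ->.
have [al alE] := factor_through_image AM Aker.
have [be beE] := factor_through_image BM Bker.
(* The transport of l has the coboundaries of al and be as its first two
   coordinates, so that it is central around every loop of G. *)
pose l g k : heis 'F_2 := (al (g * x k)%g - al g, be (g * x k)%g - be g, 0)%R.
have linv a g k : l (phi a * g) k = l g k.
  by apply: heis_ext; rewrite /hx /hy /= -?mulgA ?alE ?beE //; ring.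
have lx z g : hx (transport x l g z) = (al (g * lift x z)%g - al g)%R.
  elim/free_ind: z g => [|k|a b IHa IHb|a IHa] g.
  - by rewrite transport1 lift1 mulg1 subrr.
  - by rewrite transport_gen lift_gen.
  - by rewrite transportM hxM IHa IHb liftM mulgA; ring.
  - by rewrite transportV hxV IHa gmulfV /= mulgVK opprB.
have ly z g : hy (transport x l g z) = (be (g * lift x z)%g - be g)%R.
  elim/free_ind: z g => [|k|a b IHa IHb|a IHa] g.
  - by rewrite transport1 lift1 mulg1 subrr.
  - by rewrite transport_gen lift_gen.
  - by rewrite transportM hyM IHa IHb liftM mulgA; ring.
  - by rewrite transportV hyV IHa gmulfV /= mulgVK opprB.
have lr g : transport x l g r = hcen (hz (transport x l g r)).
  by apply: heis_ext; rewrite // ?lx ?ly xr mulg1 subrr.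
have := sP l _ lr 1; rewrite (transport_endo zsE) //.
rewrite AB1 => [|k|k].
- move/(congr1 (@hz _)); rewrite /hz /=.
  under eq_bigr do rewrite mul1g.
  rewrite sE => [|a c]; last first.
    rewrite (@transport_invariant _ _ _ x l (range phi)) //.
    by move=> _ h k [b _ <-].
  rewrite big_seq big1 // => t; rewrite mem_undup => /mapP [c cs ->].
  suff -> : (\sum_(d <- s) (T d == T c)%:R)%R = 0%R :> 'F_2 by rewrite mul0r.
  by rewrite -/(v c) -[c]mul1g vinv.
- by rewrite lx zsE -[phi _]mulg1 mul1g alE addrK.
- by rewrite ly zsE -[phi _]mulg1 mul1g beE addrK.
Qed.
End ImageCover.
(** * Images of finite index are everything *)

Lemma transport_hz (X : choiceType) (G : groupType) (R : comNzRingType)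
    (x : X -> G) (l : G -> X -> R) g a b :
  let L := fun g z => hz (transport x (fun h k => hcen (l h k)) g z) in
  (L g (a * b)%g = L g a + L (g * lift x a)%g b)%R.
Proof.
move=> L; rewrite /L transportM hzM.
by rewrite [in X in (_ + X)%R]transport_central mul0r addr0.
Qed.

Lemma transport_hzV (X : choiceType) (G : groupType) (R : comNzRingType)
    (x : X -> G) (l : G -> X -> R) g a :
  let L := fun g z => hz (transport x (fun h k => hcen (l h k)) g z) in
  (L g a^-1%g = - L (g * (lift x a)^-1)%g a)%R.
Proof.
move=> L; rewrite /L transportV hzV.
by rewrite [in X in (_ + X)%R]transport_central mul0r addr0.
Qed.

Lemma transport_hzB (X : choiceType) (G : groupType) (R : comNzRingType)
    (x : X -> G) (l l' : G -> X -> R) g z :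
  let L := fun l => hz (transport x (fun h k => hcen (l h k : R)) g z) in
  (L (fun h k => l h k - l' h k) = L l - L l')%R.
Proof.
move=> /=; elim/free_ind: z g => [|k|a b IHa IHb|a IHa] g.
- by rewrite !transport1 subrr.
- by rewrite !transport_gen.
- by rewrite !transport_hz IHa IHb; ring.
- by rewrite !transport_hzV IHa; ring.
Qed.

(** Let m be the index of the image.  A cocycle on the Schreier graph with
    values in F_3 is a label on each of its m |X| edges.  It is determined by
    its values on the m lifts of r, on the loops phi (e i), and on m - 1 paths
    from the base point to the other cosets: if all of these vanish, the cocycle
    is an additive map on the image that vanishes on generators, then a zero
    coboundary.  So m |X| <= m + b + (m - 1), which forces m = 1. *)

Section IndexOne.
Variables (X : finType) (r : free_group X) (G : groupType) (x : X -> G).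
Hypothesis rx : presents r x.
Variables (b : nat) (e : 'I_b -> G).
Hypothesis e_gen : forall C : G -> 'F_3, {morph C : a b / a * b >-> (a + b)%R} ->
  (forall i, C (e i) = 0%R) -> forall g, C g = 0%R.
Hypothesis bX : (b + 3 < 2 * #|X|)%N.
Variable phi : UMagmaMorphism.type G G.

Lemma image_full (s : seq G) :
  (forall g, exists2 c, c \in s & exists a, g = phi a * c) ->
  forall g, exists a, phi a = g.
Proof.
move=> cov; have [T [Tinv Tc]] := coset_rep phi.
have TT g : T (T g) = T g by have [a {1}->] := Tc g.
pose U := [seq T c | c <- s].
have TU g : T g \in U.
  by have [c cs [a ->]] := cov g; rewrite Tinv map_f.
pose idx g : seq_sub U := SeqSub (TU g).
have idxE g h : idx g = idx h -> exists a, g = phi a * h.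
  move/(congr1 val) => /= gh.
  have [a1 a1E] := Tc g; have [b1 b1E] := Tc h.
  by exists (a1^-1 * b1); rewrite gmulfM gmulfV -mulgA -b1E -gh a1E mulKg.
have idx_rep (i : seq_sub U) : idx (val i) = i.
  apply/val_inj => /=; case: i => u /= uU.
  by have /mapP [c _ ->] := uU; rewrite TT.
have idx_inv a g : idx (phi a * g) = idx g by apply/val_inj; rewrite /= Tinv.
have [z zE] : exists z : G -> free_group X, forall g, lift x (z g) = g.
  by case: rx => sur _; have [z ?] := choice sur; exists z.
pose lam (l : {ffun seq_sub U * X -> 'F_3}) g k : 'F_3 := l (idx g, k).
pose L l g w : 'F_3 := hz (transport x (fun h k => hcen (lam l h k)) g w).
have Linv l a g w : L l (phi a * g) w = L l g w.
  rewrite /L (@transport_invariant _ _ _ x _ (range phi)) //.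
  by move=> _ h k [c _ <-]; rewrite /lam idx_inv.
pose Psi (l : {ffun seq_sub U * X -> 'F_3}) :
    {ffun seq_sub U -> 'F_3} * {ffun 'I_b -> 'F_3} *
    {ffun {i : seq_sub U | i != idx 1} -> 'F_3} :=
  (([ffun i : seq_sub U => L l (val i) r], [ffun i : 'I_b => L l 1 (z (phi (e i)))]),
   [ffun i : {i : seq_sub U | i != idx 1} => L l 1 (z (val (val i)))]).
have Psi_inj : injective Psi.
  move=> l l' [ff ee tt]; apply/eqP; rewrite -subr_eq0; apply/eqP.
  set d := (l - l')%R.
  have LB g w : L d g w = (L l g w - L l' g w)%R.
    rewrite -transport_hzB /L; congr (hz (transport _ _ _ _)).
    by apply/funext => h; apply/funext => k; rewrite /lam !ffunE.
  have dr g : L d g r = 0%R.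
    have [a ->] : exists a, g = phi a * val (idx g) by apply: idxE; rewrite idx_rep.
    move/ffunP/(_ (idx g)): ff; rewrite !ffunE => ffE.
    by rewrite Linv LB ffE subrr.
  have de i : L d 1 (z (phi (e i))) = 0%R.
    by move/ffunP/(_ i): ee; rewrite !ffunE => eeE; rewrite LB eeE subrr.
  have dt i : i != idx 1 -> L d 1 (z (val i)) = 0%R.
    move=> i1; move/ffunP/(_ (exist _ i i1)): tt; rewrite !ffunE /= => ttE.
    by rewrite LB ttE subrr.
  (* Since d is trivial on the lifts of r, its transport D g depends on the
     element of G only. *)
  pose w := wgen x (fun h k => hcen (lam d h k)).
  have w1 : lift w r = 1.
    apply: wreath_ext => [|g].
      by rewrite wgen_fst (presents_rel rx).
    by rewrite -/(transport _ _ _ _) transport_central -/(L _ _ _) dr.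
  have [F FE] := presents_hom rx w1.
  pose D g a := L d g (z a).
  have DE g v : D g (lift x v) = L d g v.
    by rewrite /D /L /transport -/w -!FE zE.
  have DM g a c : D g (a * c) = (D g a + D (g * a)%g c)%R.
    rewrite -[a * c]zE -[z _]/(z (a * c)) -{1}[a]zE -{1}[c]zE -liftM zE DE.
    by rewrite /L transport_hz zE.
  have Dinv g a c : D (phi a * g) c = D g c by exact: Linv.
  have Dphi a : D 1 (phi a) = 0%R.
    apply: (e_gen (C := fun a => D 1 (phi a))) => [a1 c1|i]; last exact: de.
    by rewrite gmulfM DM mul1g -[phi a1 in X in (_ + X)%R]mulg1 Dinv.
  have D1 g : D 1 g = 0%R.
    have [a gE] : exists a, g = phi a * val (idx g) by apply: idxE; rewrite idx_rep.
    rewrite gE DM Dphi add0r mul1g -[phi a]mulg1 Dinv.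
    have [i1|] := eqVneq (idx g) (idx 1); last exact: dt.
    have [c ->] : exists c, val (idx g) = phi c * 1.
      by apply: idxE; rewrite idx_rep.
    by rewrite mulg1.
  apply/ffunP => -[i k]; rewrite [RHS]ffunE.
  have := DM 1 (val i) (x k).
  rewrite !D1 add0r mul1g -[x k](lift_gen x) DE /L transport_gen /hz /= /lam idx_rep.
  by move->.
have I0 : (0 < #|{: seq_sub U}|)%N by apply/card_gt0P; exists (idx 1).
have := leq_card _ Psi_inj.
rewrite !card_prod !card_ffun card_prod card_sig card_Fp // card_ord.
have -> : #|[pred i : seq_sub U | i != idx 1]| = #|{: seq_sub U}|.-1.
  by rewrite -(cardC1 (idx 1)); apply: eq_card => i; rewrite !inE.
rewrite -!expnD leq_exp2l // => le.
have m1 : (#|{: seq_sub U}| <= 1)%N.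
  move: le bX I0; case: #|_| => [|[|m]] //; move: #|_| => y le1 b1 _.
  have my : (m * 2 <= m * y)%N by rewrite leq_mul2l; apply/orP; right; lia.
  by rewrite !mulSn /= in le1; lia.
move=> g; have [a ->] : exists a, g = phi a * 1.
  apply: idxE; have /card_le1P/(_ (idx 1)) := m1.
  by move/(_ isT (idx g)); rewrite !inE => /esym/eqP.
by exists a; rewrite mulg1.
Qed.
End IndexOne.
(** * Residual finiteness and the Hopf property *)

Lemma extend_injection (T : finType) (D : {set T}) (g : T -> T) :
  {in D &, injective g} -> exists s : {perm T}, {in D, s =1 g}.
Proof.
move=> ginj; pose E := g @: D.
have cDE : #|~: D| = #|~: E|.
  by rewrite [LHS]cardsCs [RHS]cardsCs !finset.setCK card_in_imset.
pose s y := if y \in D then g y else nth y (enum (~: E)) (index y (enum (~: D))).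
have sE y : y \notin D -> s y \notin E.
  move=> yD; rewrite /s (negbTE yD) -finset.in_setC -mem_enum mem_nth //.
  by rewrite -cardE -cDE cardE index_mem mem_enum inE.
have sD y : y \in D -> s y \in E by move=> yD; rewrite /s yD imset_f.
have s_inj : injective s.
  move=> y z; have [yD|yD] := boolP (y \in D); have [zD|zD] := boolP (z \in D).
  - by rewrite /s yD zD; apply: ginj.
  - by move=> e; have := sE _ zD; rewrite -e sD.
  - by move=> e; have := sE _ yD; rewrite e sD.
  - have lt u : u \notin D -> (index u (enum (~: D)) < size (enum (~: E)))%N.
      by move=> uD; rewrite -cardE -cDE cardE index_mem mem_enum inE.
    rewrite /s (negbTE yD) (negbTE zD) (set_nth_default y) ?lt //.
    move/eqP; rewrite nth_uniq ?enum_uniq ?lt // => /eqP.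
    by apply: (index_inj y); rewrite mem_enum inE.
by exists (perm s_inj) => y yD; rewrite permE /s yD.
Qed.

Definition residually_finite (G : groupType) : Prop := forall g : G, g <> 1 ->
  exists (T : finType) (f : UMagmaMorphism.type G {perm T}), f g <> 1.

(** A word of minimal length l representing z is reduced.  It is then traced by
    a walk from 0 to l through the points 0, ..., l: the steps prescribed for
    one letter form a partial injection because consecutive letters are never
    inverse to each other, and partial injections extend to permutations. *)
Lemma free_residually_finite (Y : choiceType) (z : free_group Y) : z <> 1 ->
  exists n (f : Y -> {perm 'I_n}), lift f z <> 1.
Proof.
move=> z1.
pose P n := `[< exists w : seq (Y * bool), size w = n /\ \pi_(free_group Y) w = z >].
have exP : exists n, P n.
  by exists (size (repr z)); apply/asboolP; exists (repr z); rewrite reprK.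
case: (ex_minnP exP) => l /asboolP [w [wl wz]] lmin.
have red u a v : w <> u ++ a :: inv_letter a :: v.
  move=> wE; have /lmin : P (size (u ++ v)).
    apply/asboolP; exists (u ++ v); split=> //; rewrite -wz wE.
    exact/esym/free_piP/free_equiv_cancel.
  by rewrite -wl wE !size_cat /=; lia.
have [a0 a0w] : exists a0, a0 \in w.
  case: w wz {wl red} => [z0|a w _]; first by case: z1.
  by exists a; rewrite mem_head.
pose let_ i := nth a0 w i.
have red2 i : (i.+1 < l)%N -> let_ i.+1 <> inv_letter (let_ i).
  move=> il e; apply: (red (take i w) (let_ i) (drop i.+2 w)).
  rewrite -{1}(cat_take_drop i w) (drop_nth a0) ?wl; last by lia.
  by rewrite (drop_nth a0) ?wl //; rewrite -/(let_ i) -/(let_ i.+1) e.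
pose fwd k (i : nat) := (i < l)%N && (let_ i == (k, true)).
pose bwd k (i : nat) := (0 < i)%N && (i <= l)%N && (let_ i.-1 == (k, false)).
have fb k i : fwd k i -> bwd k i -> False.
  case: i => [|i]; first by rewrite /bwd.
  move=> /andP [il /eqP e1] /andP [/andP [_ _] /eqP /= e2].
  by apply: (red2 i) => //; rewrite e1 e2.
pose D k : {set 'I_l.+1} := [set i : 'I_l.+1 | fwd k i || bwd k i]%SET.
pose g k (i : 'I_l.+1) : 'I_l.+1 := inord (if fwd k i then i.+1 else i.-1).
have gval k (i : 'I_l.+1) : g k i = (if fwd k i then i.+1 else i.-1) :> nat.
  rewrite inordK //; case: ifP => [/andP []//|_]; have := ltn_ord i; lia.
have ginj k : {in D k &, injective (g k)}.
  move=> i j; rewrite !inE => iD jD /(congr1 val) /=; rewrite !gval => ij.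
  apply/val_inj => /=; move: iD jD ij.
  have [fi|fi] /= := boolP (fwd k i); have [fj|fj] /= := boolP (fwd k j).
  - by move=> _ _ [].
  - move=> _ bj e; exfalso; case: (nat_of_ord j) e bj => [|j'] /= e; first by lia.
    case/andP => /andP [_ jl] /eqP /=; rewrite -e => ej.
    have /andP [_ /eqP ei] := fi; apply: (red2 (nat_of_ord i)); last by rewrite ej ei.
    by rewrite e.
  - move=> bi _ e; exfalso; case: (nat_of_ord i) e bi => [|i'] /= e; first by lia.
    case/andP => /andP [_ il] /eqP /=; rewrite e => ei.
    have /andP [_ /eqP ej] := fj; apply: (red2 (nat_of_ord j)); last by rewrite ej ei.
    by rewrite -e.
  - by move=> /andP [/andP [i0 _] _] /andP [/andP [j0 _] _]; lia.
have [f fE] := choice (fun k => extend_injection (@ginj k)).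
exists l.+1, f => fz.
have walk i : (i <= l)%N -> word_eval f (take i w) ord0 = inord i.
  elim: i => [|i IH] il.
    by rewrite take0 /word_eval big_nil perm1; apply/val_inj; rewrite /= inordK.
  rewrite (take_nth a0) ?wl // -cats1 word_eval_cat permM IH 1?ltnW //.
  rewrite /word_eval big_seq1 -/(let_ i).
  case ai: (let_ i) => [k b] /=; case: b ai => ai.
    have fi : fwd k i by rewrite /fwd il ai eqxx.
    have iE : (inord i : 'I_l.+1) = i :> nat by rewrite inordK // ltnW.
    rewrite fE; last by rewrite inE iE fi.
    by apply/val_inj; rewrite /= gval iE fi inordK.
  apply: (@perm_inj _ (f k)); rewrite permKV.
  have bi : bwd k i.+1 by rewrite /bwd /= il ai eqxx.
  have iE : (inord i.+1 : 'I_l.+1) = i.+1 :> nat by rewrite inordK.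
  rewrite fE; last by rewrite inE iE bi orbT.
  apply/val_inj; rewrite /= gval iE; case: ifP => [fi|_ /=]; first by case: (fb k i.+1).
  by rewrite inordK // ltnW.
have := walk l (leqnn l).
rewrite take_oversize ?wl // -lift_pi wz fz perm1.
move/(congr1 val); rewrite /= inordK // => l0.
by move: a0w; rewrite (size0nil (etrans wl (esym l0))).
Qed.

Section Hopfian.
Variables (X : finType) (r : free_group X) (G : groupType) (x : X -> G).
Hypotheses (rx : presents r x) (Gfin : residually_finite G).
Variable phi : UMagmaMorphism.type G G.
Hypothesis phi_sur : forall g, exists a, phi a = g.

(** Precomposition with a surjective phi is an injection of the finite set of
    homomorphisms from G to a finite group, hence a bijection; so every such
    homomorphism kills the kernel of phi. *)
Lemma hopfian : injective phi.
Proof.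
apply: gmulf_inj => g pg; apply: contrapT => /Gfin [T [f fg]].
have [z zE] : exists z : G -> free_group X, forall g, lift x (z g) = g.
  by case: rx => sur _; have [z ?] := choice sur; exists z.
pose D := [set y : {ffun X -> {perm T}} | lift y r == 1]%SET.
pose Phi (y : {ffun X -> {perm T}}) := [ffun k => lift y (z (phi (x k)))].
have PhiE y w : y \in D -> lift (Phi y) w = lift y (z (phi (lift x w))).
  rewrite inE => /eqP yr; have [F FE] := presents_hom rx yr.
  rewrite -FE zE !gmulf_lift; congr (lift _ w); apply/funext => k /=.
  by rewrite ffunE -FE zE.
have PhiD y : y \in D -> Phi y \in D.
  move=> yD; rewrite inE PhiE // (presents_rel rx) gmulf1.
  move: yD; rewrite inE => /eqP yr; have [F FE] := presents_hom rx yr.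
  by rewrite -FE zE gmulf1.
have Phi_inj : {in D &, injective Phi}.
  move=> y y' yD y'D e; apply/ffunP => k.
  have [a aE] := phi_sur (x k).
  have : lift (Phi y) (z a) = lift (Phi y') (z a) by rewrite e.
  rewrite !PhiE // zE aE.
  move: yD y'D; rewrite !inE => /eqP yr /eqP y'r.
  have [F FE] := presents_hom rx yr; have [F' FE'] := presents_hom rx y'r.
  by rewrite -FE -FE' zE -[x k](lift_gen x) FE FE' !lift_gen.
have PhiDD : Phi @: D = D.
  apply/eqP; rewrite eqEcard card_in_imset // leqnn andbT.
  by apply/fintype.subsetP => _ /imsetP [y yD ->]; exact: PhiD.
pose y0 := [ffun k => f (x k)].
have y0E w : lift y0 w = f (lift x w).
  by rewrite gmulf_lift; congr (lift _ w); apply/funext => k; rewrite ffunE.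
have : y0 \in Phi @: D by rewrite PhiDD inE y0E (presents_rel rx) gmulf1.
case/imsetP => y1 y1D y0y1; apply: fg.
rewrite -[g]zE -y0E y0y1 PhiE // zE pg.
move: y1D; rewrite inE => /eqP yr; have [F FE] := presents_hom rx yr.
by rewrite -FE zE gmulf1.
Qed.
End Hopfian.
(** * Residual finiteness of a family of HNN extensions *)

Lemma iter_ordS n k (i : 'I_n.+1) :
  iter k (@ordS n.+1) i = ((i + k) %% n.+1)%N :> nat.
Proof.
elim: k => [|k IH]; first by rewrite addn0 modn_small.
by rewrite iterS /= IH -addn1 modnDml addn1 addnS.
Qed.

(** The group G is generated by t, a and the u j, with the single relation
    t a t^-1 = P a^(+-1) Q, where P and Q are words in the u j.  The conjugates
    t^i (u j) t^-i and a behave as free generators permuted by t except for the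
    replacement of a by P a^(+-1) Q.  Letting the exponents i run through a
    finite cyclic group, the same rule makes t act on the finite set of maps
    from these generators to a finite group. *)

Section AscendingHNN.
Variables (J : finType) (P Q : free_group J) (eps : bool).

Definition hnn_rel (H : groupType) (t a : H) (u : J -> H) : Prop :=
  t * a * t^-1 = lift u P * (if eps then a else a^-1) * lift u Q.

Section Shift.
Variables n m : nat.

Let W := {ffun option (J * 'I_m.+1) -> {perm 'I_n}}.

Definition base_letter (w : W) (j : J) : {perm 'I_n} := w (Some (j, ord0)).

(** Precomposition of the homomorphism w with conjugation by t. *)
Definition shift (w : W) : W := [ffun y => if y is Some (j, i)
  then w (Some (j, ordS i))
  else lift (base_letter w) P * (if eps then w None else (w None)^-1) *
       lift (base_letter w) Q].

Lemma shift_inj : injective shift.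
Proof.
move=> w w' e.
have eS j i : w (Some (j, i)) = w' (Some (j, i)).
  move/ffunP/(_ (Some (j, ord_pred i))): e; rewrite !ffunE.
  by rewrite ord_predK.
have eb : base_letter w = base_letter w'.
  by apply/funext => j; rewrite /base_letter eS.
apply/ffunP => -[[j i]|]; first exact: eS.
move/ffunP/(_ None): e; rewrite !ffunE eb => /mulIg /mulgI.
by case: eps => // /invg_inj.
Qed.

Lemma shift_fun_inj : injective (fun p : W * 'I_n => (shift p.1, p.2)).
Proof. by move=> [w s] [w' s'] /= [/shift_inj -> ->]. Qed.

(** The second factor is a fibre on which the elements other than t act, through
    the value of w; this makes the relation hold. *)
Definition shift_perm : {perm W * 'I_n} := perm shift_fun_inj.

Lemma fiber_inj (c : W -> {perm 'I_n}) :
  injective (fun p : W * 'I_n => (p.1, c p.1 p.2)).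
Proof. by move=> [w s] [w' s'] /= [<- /perm_inj ->]. Qed.

Definition fiber_perm (c : W -> {perm 'I_n}) : {perm W * 'I_n} :=
  perm (@fiber_inj c).

Lemma fiber_permM c d : fiber_perm (fun w => c w * d w) = fiber_perm c * fiber_perm d.
Proof. by apply/permP => -[w s]; rewrite permM !permE /= ?permM ?permE. Qed.

Lemma fiber_perm1 : fiber_perm (fun=> 1) = 1.
Proof. by apply/permP => -[w s]; rewrite !permE. Qed.

Lemma fiber_permV c : fiber_perm (fun w => (c w)^-1) = (fiber_perm c)^-1.
Proof.
apply/esym/mulg1_eq; rewrite -fiber_permM -fiber_perm1; congr fiber_perm.
by apply/funext => w; rewrite mulgV.
Qed.

Lemma fiber_perm_lift (Y : choiceType) (c : Y -> W -> {perm 'I_n}) z :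
  lift (fun y => fiber_perm (c y)) z = fiber_perm (fun w => lift (c^~ w) z).
Proof.
elim/free_ind: z => [|k|a b IHa IHb|a IHa].
- by rewrite lift1 -fiber_perm1; congr fiber_perm; apply/funext => w; rewrite lift1.
- by rewrite lift_gen; congr fiber_perm; apply/funext => w; rewrite lift_gen.
- rewrite liftM IHa IHb -fiber_permM; congr fiber_perm.
  by apply/funext => w; rewrite liftM.
- rewrite gmulfV /= IHa -fiber_permV; congr fiber_perm.
  by apply/funext => w; rewrite gmulfV.
Qed.

Lemma shift_fiber c :
  shift_perm * fiber_perm c * shift_perm^-1 = fiber_perm (c \o shift).
Proof.
apply: (@mulIg _ shift_perm); rewrite mulgVK.
by apply/permP => -[w s]; rewrite !permM !permE.
Qed.

Lemma shiftX_fiber c i : shift_perm ^+ i * fiber_perm c * shift_perm ^- i =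
  fiber_perm (fun w => c (iter i shift w)).
Proof.
elim: i c => [|i IH] c; first by rewrite expg0 mul1g invg1 mulg1.
rewrite expgSr invgM; have := IH (c \o shift); rewrite -shift_fiber !mulgA => ->.
by congr fiber_perm.
Qed.

Lemma iter_shift i w j i0 :
  iter i shift w (Some (j, i0)) = w (Some (j, iter i (@ordS m.+1) i0)).
Proof. by elim: i i0 => [|i IH] i0 //=; rewrite ffunE IH -iterSr. Qed.

Lemma shift_hnn_rel :
  hnn_rel shift_perm (fiber_perm (fun w => w None))
    (fun j => fiber_perm (fun w => base_letter w j)).
Proof.
rewrite /hnn_rel shift_fiber !fiber_perm_lift.
have -> : (if eps then fiber_perm (fun w => w None)
           else (fiber_perm (fun w => w None))^-1) =
    fiber_perm (fun w => if eps then w None else (w None)^-1).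
  by case: eps; rewrite // fiber_permV.
rewrite -!fiber_permM; congr fiber_perm.
by apply/funext => w /=; rewrite ffunE.
Qed.

End Shift.

Variables (G : groupType) (t a : G) (u : J -> G).
Hypothesis rel : hnn_rel t a u.
Hypothesis gen : forall S : set G, S 1 -> (forall g h, S g -> S h -> S (g * h)) ->
  (forall g, S g -> S g^-1) -> S t -> S a -> (forall j, S (u j)) -> forall g, S g.
Hypothesis univ : forall (H : groupType) (t' a' : H) (u' : J -> H),
  hnn_rel t' a' u' -> exists f : UMagmaMorphism.type G H,
  [/\ f t = t', f a = a' & forall j, f (u j) = u' j].

Let Y := option (J * nat).

Definition hnn_letter (y : Y) : G :=
  if y is Some (j, i) then t ^+ i * u j * t ^- i else a.

(** Conjugation by t preserves the subgroup generated by a and the conjugates of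
    the u j with nonnegative exponents.  Hence the negative powers of t in
    a product can be gathered on the left and the positive ones on the right. *)
Lemma hnn_shift (l : free_group Y) :
  exists l', t * lift hnn_letter l * t^-1 = lift hnn_letter l'.
Proof.
have LU z : lift hnn_letter (lift (fun j => free_gen (Some (j, 0))) z) = lift u z.
  rewrite gmulf_lift; congr lift; apply/funext => j /=.
  by rewrite lift_gen /= expg0 mul1g invg1 mulg1.
elim/free_ind: l => [|[[j i]|]|l l' [m mE] [m' m'E]|l [m mE]].
- by exists 1; rewrite !lift1 mulg1 mulgV.
- exists (free_gen (Some (j, i.+1))); rewrite !lift_gen /=.
  by rewrite expgS invgM !mulgA.
- pose e : free_group Y := if eps then free_gen None else (free_gen None)^-1.
  exists (lift (fun j => free_gen (Some (j, 0))) P * e *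
          lift (fun j => free_gen (Some (j, 0))) Q).
  rewrite lift_gen /= rel !liftM !LU; congr (_ * _ * _).
  by rewrite /e; case: ifP; rewrite ?gmulfV /= lift_gen.
- by exists (m * m'); rewrite !liftM -mE -m'E !mulgA mulgVK.
- by exists m^-1; rewrite !gmulfV /= -mE !invgM invgK !mulgA.
Qed.

Lemma hnn_shiftX (l : free_group Y) n :
  exists l', t ^+ n * lift hnn_letter l * t ^- n = lift hnn_letter l'.
Proof.
elim: n => [|n [l' IH]]; first by exists l; rewrite expg0 mul1g invg1 mulg1.
have [m mE] := hnn_shift l'; exists m.
by rewrite -mE -IH expgS invgM !mulgA.
Qed.

(** An element is a conjugate by a power of t of an element of the previous
    subgroup, up to its image in the infinite cyclic quotient. *)
Lemma hnn_form g : exists c l k, g = t ^- c * lift hnn_letter l * t ^+ k.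
Proof.
pose F : set G := [set g | exists c l k, g = t ^- c * lift hnn_letter l * t ^+ k].
have F1 : F 1 by exists 0, 1, 0; rewrite lift1 expg0 invg1 !mulg1.
have FL h l : F h -> F (h * lift hnn_letter l).
  move=> [c [m [k ->]]]; have [l' l'E] := hnn_shiftX l k.
  by exists c, (m * l'), k; rewrite liftM -l'E !mulgA mulgVK.
have Fletter y : forall h, F h -> F (h * hnn_letter y) /\ F (h * (hnn_letter y)^-1).
  move=> h Fh; split.
    by rewrite -(lift_gen hnn_letter); exact: FL.
  by rewrite -(lift_gen hnn_letter) -gmulfV; exact: FL.
suff /(_ 1 F1) [] : forall h, F h -> F (h * g) /\ F (h * g^-1).
  by rewrite mul1g.
pose S : set G := [set g | forall h, F h -> F (h * g) /\ F (h * g^-1)].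
suff : S g by [].
apply: (gen (S := S)) => [h|b c /= Fb Fc h|b /= Fb h|h|h|j h] /=.
- by rewrite invg1 mulg1.
- move=> Fh; rewrite invgM !mulgA; split.
    exact: (Fc _ (Fb _ Fh).1).1.
  exact: (Fb _ (Fc _ Fh).2).2.
- by rewrite invgK => /Fb [].
- move=> [c [l [k ->]]]; split.
    by exists c, l, k.+1; rewrite expgSr !mulgA.
  case: k => [|k].
    have [l' l'E] := hnn_shift l.
    exists c.+1, l', 0; rewrite -l'E expgS invgM !expg0 !mulg1 !mulgA.
    by rewrite mulgVK.
  by exists c, l, k; rewrite expgSr !mulgA mulgK.
- exact: (Fletter None).
- by have := Fletter (Some (j, 0)) h; rewrite /= expg0 mul1g invg1 mulg1.
Qed.

(** If g has a nonzero exponent in t, a cyclic quotient detects it.  Otherwise g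
    is conjugate to the value of a nontrivial element l of a free group, and a
    finite permutation representation of that free group which detects l gives
    a point w1 of the set on which G acts. *)
Lemma hnn_residually_finite : residually_finite G.
Proof.
move=> g g1; have [c [l [k gE]]] := hnn_form g.
have [ck|ck] := eqVneq c k; last first.
  pose rot : {perm 'I_(c + k).+1} := perm (@ordS_inj (c + k).+1).
  have l1 z : lift (fun=> 1 : {perm 'I_(c + k).+1}) z = 1 :> {perm _}.
    elim/free_ind: z => [|y|z z' IH IH'|z IH];
      by rewrite ?lift1 ?lift_gen ?liftM ?IH ?IH' ?mulg1 ?gmulfV /= ?IH ?invg1.
  have rot_rel : hnn_rel rot 1 (fun=> 1).
    by rewrite /hnn_rel !l1; case: eps; rewrite ?invg1 !mulg1 mulgV.
  have [f [ft fa fu]] := univ rot_rel.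
  exists 'I_(c + k).+1, f; rewrite gE !gmulfM gmulfV !gmulfXn ft gmulf_lift.
  have -> : f \o hnn_letter = fun=> 1.
    apply/funext => -[[j i]|] //=.
    by rewrite !gmulfM gmulfV !gmulfXn ft fu mulg1 mulgV.
  rewrite l1 mulg1 => /mulg1_eq; rewrite invgK => /permP /(_ ord0).
  rewrite !permX => /(congr1 val) /=.
  rewrite !(eq_iter (permE _)) !iter_ordS !add0n !modn_small; [|lia|lia].
  by move/eqP; rewrite (negbTE ck).
move: g1; rewrite gE -ck => g1.
have l1 : l <> 1 by move=> l1; case: g1; rewrite l1 lift1 mulg1 mulVg.
have [n [f0 f0l]] := free_residually_finite l1.
pose ind (y : Y) := if y is Some (j, i) then i else 0.
pose m := \max_(b <- repr l) ind b.1.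
have [f [ft fa fu]] := univ (shift_hnn_rel n m).
exists ({ffun option (J * 'I_m.+1) -> {perm 'I_n}} * 'I_n)%type, f => fg; apply: f0l.
pose d (y : Y) (w : {ffun option (J * 'I_m.+1) -> {perm 'I_n}}) :=
  if y is Some (j, i) then base_letter (iter i (@shift n m) w) j else w None.
have fL : f (lift hnn_letter l) = fiber_perm (fun w => lift (d^~ w) l).
  rewrite gmulf_lift -(fiber_perm_lift d); congr (lift _ l).
  apply/funext => -[[j i]|] //=.
  by rewrite !gmulfM gmulfV !gmulfXn ft fu shiftX_fiber.
have {fg} fL1 : f (lift hnn_letter l) = 1.
  move: fg; rewrite !gmulfM gmulfV => /mulg1_eq; rewrite invgM invgK => e.
  by apply/invg_inj/(@mulIg _ (f (t ^+ c))); rewrite e invg1 mul1g.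
(* The exponents occurring in l are at most m, so that reducing them modulo
   m + 1 loses nothing. *)
pose w1 : {ffun option (J * 'I_m.+1) -> {perm 'I_n}} :=
  [ffun y => if y is Some (j, i) then f0 (Some (j, nat_of_ord i)) else f0 None].
have <- : lift (d^~ w1) l = lift f0 l.
  rewrite /lift /word_eval; apply: eq_big_seq => -[y b] yl.
  suff -> : d y w1 = f0 y by [].
  have : (ind (y, b).1 <= m)%N by rewrite /m; apply: (leq_bigmax_seq (y, b) yl isT).
  case: y yl => [[j i]|] yl /= im; rewrite /d ?ffunE //.
  rewrite /base_letter iter_shift ffunE; congr (f0 (Some (j, _))).
  by rewrite iter_ordS add0n modn_small.
apply/permP => s; move/permP/(_ (w1, s)): fL1.
by rewrite fL !permE => -[].
Qed.

End AscendingHNN.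
(** * A criterion modulo p, and density *)

(** The c i are coordinates on Hom(G, Z) dual to the elements e i, which span
    H_1(G; Z) modulo torsion. *)

Section Criterion.
Variables (X : finType) (r : free_group X) (G : groupType) (x : X -> G).
Hypotheses (rx : presents r x) (rquad : quadratic r x) (Gfin : residually_finite G).
Variables (b : nat) (e : 'I_b -> G) (c : 'I_b -> G -> int).
Hypothesis cM : forall i, {morph c i : g h / g * h >-> (g + h)%R}.
Hypothesis e_gen : forall V : zmodType, (forall v : V, (v + v = 0 -> v = 0)%R) ->
  forall C : G -> V, {morph C : g h / g * h >-> (g + h)%R} ->
  (forall i, C (e i) = 0%R) -> forall g, C g = 0%R.
Hypothesis ce : forall i j, c i (e j) = (i == j)%:R%R.
Hypothesis bX : (b + 3 < 2 * #|X|)%N.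
Variables A B : G -> int.
Hypotheses (AM : {morph A : g h / g * h >-> (g + h)%R})
  (BM : {morph B : g h / g * h >-> (g + h)%R}).
Hypothesis AB1 : cup_nonzero r (fun k => (A (x k))%:~R%R) (fun k => (B (x k))%:~R%R).

Lemma additive_coord (C : G -> int) : {morph C : g h / g * h >-> (g + h)%R} ->
  forall g, C g = (\sum_i c i g * C (e i))%R.
Proof.
move=> CM g; apply/eqP; rewrite -subr_eq0; apply/eqP.
apply: (@e_gen int _ (fun g => (C g - \sum_i c i g * C (e i))%R)) => [v|h k|i].
- by lia.
- rewrite CM; under eq_bigr do rewrite cM mulrDl.
  by rewrite big_split /=; ring.
- rewrite (bigD1 i) //= ce eqxx mul1r big1 ?addr0 ?subrr // => j /negbTE ji.
  by rewrite ce ji mul0r.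
Qed.

(** The hypothesis says that the matrix J of phi on H_1 modulo torsion is
    invertible modulo p.  Its integral determinant is therefore nonzero, so that
    every integral class vanishes on the kernel of phi, as image_cover needs. *)
Lemma bijective_of_mod_p (phi : UMagmaMorphism.type G G) (p : nat) : prime p ->
  (forall al : 'I_b -> 'F_p,
     (forall g, \sum_j al j * (c j (phi g))%:~R = 0)%R -> forall j, al j = 0%R) ->
  bijective phi.
Proof.
move=> p_pr al0.
pose J : 'M[int]_b := (\matrix_(i, j) c j (phi (e i)))%R.
have cphi g j : c j (phi g) = (\sum_i c i g * J i j)%R.
  rewrite -[LHS]/((c j \o phi) g) additive_coord => [|h k /=]; last first.
    by rewrite gmulfM cM.
  by apply: eq_bigr => i _; rewrite mxE.
(* Otherwise the transpose of J modulo p has a nonzero kernel vector. *)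
have detJ : (\det J != 0)%R.
  apply/negP => /eqP dJ.
  pose Jp : 'M['F_p]_b := map_mx intr J.
  have : (\det Jp^T == 0)%R by rewrite det_tr det_map_mx dJ.
  case/det0P => v v0 vJ; case/negP: v0; apply/eqP/rowP => j; rewrite mxE.
  apply: (al0 (fun j => v ord0 j)) => g.
  under eq_bigr do rewrite cphi rmorph_sum mulr_sumr /=.
  rewrite exchange_big big1 //= => i _.
  have /rowP/(_ i) := vJ; rewrite !mxE => vJi.
  under eq_bigr do rewrite rmorphM mulrCA.
  rewrite -mulr_sumr /=; set s := (\sum_(k < b) _)%R.
  suff -> : s = 0%R by rewrite mulr0.
  by rewrite -vJi; apply: eq_bigr => k _; rewrite !mxE.
have cker g : phi g = 1 -> forall i, c i g = 0%R.
  move=> pg i; pose v := (\row_i c i g)%R : 'rV[int]_b.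
  have vJ : (v *m J = 0)%R.
    apply/rowP => j; rewrite !mxE.
    under eq_bigr do rewrite mxE.
    rewrite -cphi pg; apply: (@addrI _ (c j 1)).
    by rewrite -cM mulg1 addr0.
  have : (v *m J *m \adj J = 0)%R by rewrite vJ mul0mx.
  rewrite -mulmxA mul_mx_adj mul_mx_scalar => /rowP/(_ i); rewrite !mxE.
  by move/eqP; rewrite mulf_eq0 (negbTE detJ) => /eqP.
have addker (C : G -> int) : {morph C : g h / g * h >-> (g + h)%R} ->
    forall g, phi g = 1 -> ((C g)%:~R = 0 :> 'F_2)%R.
  move=> CM g pg; rewrite additive_coord // big1 // => i _.
  by rewrite cker // mul0r.
have intM (C : G -> int) : {morph C : g h / g * h >-> (g + h)%R} ->
    {morph (fun g => (C g)%:~R%R : 'F_2) : g h / g * h >-> (g + h)%R}.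
  by move=> CM g h; rewrite CM rmorphD.
have [s cov] := image_cover rx rquad (intM _ AM) (intM _ BM) AB1
  (addker _ AM) (addker _ BM).
have sur : forall g, exists a, phi a = g.
  apply: (image_full rx (e := e) _ bX cov) => C CM Ce.
  apply: (@e_gen 'F_3 _ C CM Ce) => v /eqP.
  by case: v => -[|[|[|//]]] // v3; rewrite ?eqE //= => _; apply/val_inj.
have inj := hopfian rx Gfin sur.
have [psi psiE] := choice sur.
exists psi => g; last exact: psiE.
by apply: inj; rewrite psiE.
Qed.

End Criterion.

(** Among the cosets of 1, g, ..., g^n with n the number of cosets two coincide,
    so some positive power of g with exponent at most n lies in N; n! is a
    multiple of all these exponents. *)
Lemma finite_index_expg (G : groupType) (N : set G) :
  normal_subgroup N -> finite_index N ->
  exists2 m, (0 < m)%N & forall g, N (g ^+ m).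
Proof.
move=> nN /finite_seqP [s sE].
have NX g k : N g -> N (g ^+ k).
  move=> Ng; elim: k => [|k IH]; first exact: nsub1 nN.
  by rewrite expgS; apply: (nsubM nN).
exists (size s)`!; first exact: fact_gt0.
move=> g; pose F (i : 'I_(size s).+1) := index (lcoset_set (g ^+ i) N) s.
have Fs i : (F i < size s)%N.
  rewrite index_mem; have : [set` s] (lcoset_set (g ^+ i) N); last by [].
  by rewrite -sE; exists (g ^+ i).
pose F' i := Ordinal (Fs i).
have : ~~ injectiveb F'.
  apply/negP => /injectiveP /leq_card; by rewrite !card_ord ltnn.
case/injectivePn => i [j ij] /(congr1 val) /= Fij.
have {Fij} ijN : lcoset_set (g ^+ i) N = lcoset_set (g ^+ j) N.
  have := congr1 (nth setT s) Fij; rewrite !nth_index //.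
    by rewrite -index_mem; exact: Fs.
  by rewrite -index_mem; exact: Fs.
wlog lij : i j ij ijN / (i < j)%N.
  move=> W; have [lt|le] := ltnP i j; first exact: (W i j).
  by apply: (W j i); rewrite ?ltn_neqAle ?le ?andbT // eq_sym // val_eqE.
have Nji : N (g ^+ (j - i)).
  have : lcoset_set (g ^+ j) N (g ^+ j).
    by rewrite lcoset_setE /= mulVg; exact: nsub1 nN.
  rewrite -ijN lcoset_setE /= -{1}(subnKC (ltnW lij)) expgnDr mulKg.
  by [].
have /dvdnP [q ->] : (j - i %| (size s)`!)%N.
  by rewrite dvdn_fact // subn_gt0 lij (leq_trans (leq_subr i j)) // -ltnS ltn_ord.
by rewrite mulnC expgnA; exact: NX.
Qed.

(** By the theorem of Euler the exponent s = p^(2 totient m) is congruent to 1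
    modulo m, so g^s h0^m is in the coset of g, whatever h0 is. *)
Lemma dense_test_elements (G : groupType) :
  (forall p, prime p -> (2 < p)%N -> exists h0 : G, forall g (s m : nat),
     (p ^ 2 %| s)%N -> coprime p m -> test_element (g ^+ s * h0 ^+ m)) ->
  dense ([set g : G | test_element g] : set (profinite G)).
Proof.
move=> H O [g Og] [D' sD OE].
move: Og; rewrite -OE => -[_ /[dup] /sD [g0 [N [nN fN ->]]] DN Ng].
have [m m0 Nm] := finite_index_expg nN fN.
have [p mp p_pr] := prime_above (m + 2).
have [|h0 h0P] := H p p_pr; first by lia.
have cpm : coprime p m.
  by rewrite prime_coprime // gtnNdvd //; lia.
pose s := (p ^ (2 * totient m))%N.
have ps : (p ^ 2 %| s)%N.
  by rewrite dvdn_exp2l // leq_pmulr // totient_gt0.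
have [q sq] : exists q, s = (q * m + 1)%N.
  have s1 : (s = 1 %[mod m])%N.
    rewrite /s mulnC expnM -modnXm cyclic.Euler_exp_totient // modnXm.
    by rewrite exp1n.
  have s0 : (0 < s)%N by rewrite expn_gt0 prime_gt0.
  have /dvdnP [q qE] : (m %| s - 1)%N by rewrite -eqn_mod_dvd //; apply/eqP.
  by exists q; rewrite -qE subnK.
exists (g ^+ s * h0 ^+ m); split; last exact: h0P.
exists (lcoset_set g0 N) => //.
move: Ng; rewrite !lcoset_setE /= => Ng.
rewrite sq addn1 expgS !mulgA -mulgA; apply: (nsubM nN) => //.
apply: (nsubM nN) => //; rewrite mulnC expgnA.
by elim: q {sq} => [|q IH]; [exact: nsub1 nN | rewrite expgS; apply: (nsubM nN)].
Qed.
(** * Tools for the two families of surface groups *)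

Lemma transport_prefix (X : choiceType) (G U : groupType) (x : X -> G)
    (l : G -> X -> U) (F : nat -> free_group X) n g :
  transport x l g (\prod_(0 <= i < n) F i) =
  \prod_(0 <= i < n) transport x l (g * lift x (\prod_(0 <= j < i) F j)) (F i).
Proof.
elim: n => [|n IH]; first by rewrite !big_nil transport1.
by rewrite !big_nat_recr //= transportM IH.
Qed.

Lemma prod_ord_nat (H : monoidType) n (F : 'I_n.+1 -> H) :
  \prod_(i < n.+1) F i = \prod_(0 <= i < n.+1) F (inord i).
Proof. by rewrite big_mkord; apply: eq_bigr => i _; rewrite inord_val. Qed.

Lemma mulrn_dvd_Fp (p n : nat) (v : 'F_p) : prime p -> (p %| n)%N -> (v *+ n = 0)%R.
Proof.
move=> p_pr /dvdnP [q ->]; rewrite mulnC mulrnA.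
have /pcharf0 p0 := pchar_Fp p_pr.
by rewrite -[v]mul1r -mulrnAl p0 mul0r mul0rn.
Qed.

(** This fails for p = 2, because of the binomial coefficient in hzX. *)
Lemma heis_expg_dvd (p s : nat) (u : heis 'F_p) :
  prime p -> (2 < p)%N -> (p %| s)%N -> u ^+ s = 1.
Proof.
move=> p_pr p2 ps; apply: heis_ext.
- by rewrite hxX mulrn_dvd_Fp.
- by rewrite hyX mulrn_dvd_Fp.
rewrite hzX !(mulrn_dvd_Fp _ p_pr) ?addr0 //.
have : (p %| 2 * 'C(s, 2))%N.
  rewrite mul2n bin2 -[X in X.*2]/(_./2) even_halfK ?dvdn_mulr // oddM.
  by case: s {ps} => //= s; rewrite andNb.
by rewrite Gauss_dvdr // prime_coprime // gtnNdvd.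
Qed.

Lemma proportional (F : fieldType) (X : finType) (u v : X -> F) :
  (forall w : X -> F, (\sum_k u k * w k = 0 -> \sum_k v k * w k = 0)%R) ->
  (exists k, u k != 0%R) -> exists c, forall k, v k = (c * u k)%R.
Proof.
move=> uv [k uk]; exists (v k / u k)%R => j.
have [->|jk] := eqVneq j k; first by rewrite mulrVK ?unitfE.
have sE (z : X -> F) :
    (\sum_i z i * (if i == j then u k else if i == k then - u j else 0) =
    z j * u k - z k * u j)%R.
  have kj : (k == j) = false by rewrite eq_sym (negbTE jk).
  rewrite (bigD1 j) //= eqxx (bigD1 k) /= ?kj // eqxx.
  rewrite big1 ?addr0 ?mulrN // => i /andP [/negbTE -> /negbTE ->].
  by rewrite mulr0.
have /uv : (\sum_i u i * (if i == j then u k else if i == k then - u j else 0) = 0)%R.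
  by rewrite sE; ring.
rewrite sE => /subr0_eq e.
by apply: (mulIf uk); rewrite e [RHS]mulrAC divfK.
Qed.

Lemma char_poly_trmx (R : comNzRingType) n (D : 'M[R]_n) :
  char_poly D^T = char_poly D.
Proof.
rewrite /char_poly -[RHS]det_tr; congr (\det _)%R.
by apply/matrixP => i j; rewrite !mxE eq_sym.
Qed.

(** The map c -> c^n - c takes the same value at 0 and 1, so it is not
    injective, hence not surjective on a finite field.  If it misses c0, the
    companion matrix of X^n - X - c0 has no eigenvalue, and neither has its
    transpose, which has the same characteristic polynomial. *)
Lemma eigenvalue_free (F : finFieldType) n : (1 < n)%N ->
  exists D : 'M[F]_n, forall c, ~~ eigenvalue D c /\ ~~ eigenvalue D^T c.
Proof.
move=> n1.
have [c0 c0P] : exists c0 : F, forall c, (c ^+ n - c <> c0)%R.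
  pose f (c : F) := (c ^+ n - c)%R.
  have : ~~ injectiveb f.
    apply/negP => /injectiveP /(_ 0%R 1%R).
    rewrite /f expr1n expr0n gtn_eqF 1?ltnW // !subrr => /(_ erefl) /eqP.
    by rewrite eq_sym oner_eq0.
  move=> ninj; apply: contrapT => nex; move/negP: ninj; apply; apply/injectiveP.
  have sur c0 : exists c, f c = c0.
    by apply: contrapT => nc; apply: nex; exists c0 => c fc; apply: nc; exists c.
  have [g gE] := choice sur.
  have ginj : injective g by move=> a b e; rewrite -[a]gE e gE.
  have [g' g'K gK'] := injF_bij ginj.
  by move=> a b; rewrite -[a]gK' -[b]gK' !gE => ->.
pose q := ('X^n - 'X - c0%:P : {poly F})%R.
have szr : (size ('X + c0%:P : {poly F})%R < n.+1)%N.
  by rewrite size_XaddC.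
have szq : size q = n.+1.
  by rewrite /q -addrA -opprD size_polyDl size_polyXn // size_polyN.
have qm : q \is monic.
  by rewrite monicE /q -addrA -opprD lead_coefDl ?lead_coefXn // size_polyN size_polyXn.
have qr c : ~~ root q c.
  by rewrite /root /q !hornerE; apply/negP => /eqP /subr0_eq /c0P.
have : exists D : 'M[F]_((size q).-1), char_poly D = q.
  by exists (companionmx q); exact: companionmxK.
rewrite szq /= => -[D DE]; exists D => c.
by rewrite !eigenvalue_root_char char_poly_trmx DE.
Qed.
(** * Orientable surface groups *)

Section OrdDouble.
Variable n : nat.

Lemma half_ord_subproof (k : 'I_n.*2) : (k./2 < n)%N.
Proof.
rewrite -ltn_double; apply: leq_ltn_trans (ltn_ord k).
by rewrite -[leqRHS]odd_double_half leq_addl.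
Qed.

Definition half_ord (k : 'I_n.*2) : 'I_n := Ordinal (half_ord_subproof k).

Lemma half_dbl i : half_ord (ord_dbl i) = i.
Proof. by apply/val_inj; rewrite /= doubleK. Qed.
Lemma half_dblS i : half_ord (ord_dblS i) = i.
Proof. by apply/val_inj; rewrite /= uphalf_double. Qed.
Lemma odd_dbl (i : 'I_n) : odd (ord_dbl i) = false.
Proof. by rewrite /= odd_double. Qed.
Lemma odd_dblS (i : 'I_n) : odd (ord_dblS i) = true.
Proof. by rewrite /= odd_double. Qed.

Lemma ord_dbl_half (k : 'I_n.*2) :
  (if odd k then ord_dblS (half_ord k) else ord_dbl (half_ord k)) = k.
Proof. by apply/val_inj; case: ifP => /= ok; rewrite -[RHS]odd_double_half ok. Qed.

Lemma dblP (P : 'I_n.*2 -> Prop) :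
  (forall i, P (ord_dbl i)) -> (forall i, P (ord_dblS i)) -> forall k, P k.
Proof. by move=> P0 P1 k; rewrite -[k]ord_dbl_half; case: ifP. Qed.

Lemma big_dbl (V : nmodType) (F : 'I_n.*2 -> V) :
  (\sum_k F k = \sum_i (F (ord_dbl i) + F (ord_dblS i)))%R.
Proof.
rewrite (bigID (fun k : 'I_n.*2 => odd k)) /= addrC big_split /=; congr (_ + _)%R.
  rewrite (reindex_onto (@ord_dbl n) half_ord) /=.
    by apply: eq_bigl => i; rewrite odd_double half_dbl eqxx.
  by move=> k /negbTE ok; have := ord_dbl_half k; rewrite ok.
rewrite (reindex_onto (@ord_dblS n) half_ord) /=.
  by apply: eq_bigl => i; rewrite odd_double half_dblS eqxx.
by move=> k ok; have := ord_dbl_half k; rewrite ok.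
Qed.

Lemma dbl_eq (i j : 'I_n) : (ord_dbl i == ord_dbl j) = (i == j).
Proof. by apply/eqP/eqP => [/(congr1 half_ord)|->//]; rewrite !half_dbl. Qed.
Lemma dbl_dblS_eq (i j : 'I_n) : (ord_dbl i == ord_dblS j) = false.
Proof.
by apply/eqP => /(congr1 (fun k : 'I_n.*2 => odd k)); rewrite odd_dbl odd_dblS.
Qed.
Lemma dblS_dbl_eq (i j : 'I_n) : (ord_dblS i == ord_dbl j) = false.
Proof. by rewrite eq_sym dbl_dblS_eq. Qed.

End OrdDouble.

Lemma lift_orientable n (H : groupType) (y : 'I_n.*2 -> H) :
  lift y (orientable_relator n) =
  \prod_(i < n) [~ y (ord_dbl i), y (ord_dblS i)].
Proof.
rewrite gmulf_prod; apply: eq_bigr => i _.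
by rewrite gmulfR /= !lift_gen.
Qed.

Lemma lift_orientable_heis n (R : comNzRingType) (y : 'I_n.*2 -> heis R) :
  lift y (orientable_relator n) = hcen (\sum_(i < n)
    (hx (y (ord_dbl i)) * hy (y (ord_dblS i)) -
     hx (y (ord_dblS i)) * hy (y (ord_dbl i))))%R.
Proof.
by rewrite lift_orientable hcen_sum; apply: eq_bigr => i _; rewrite heis_comm.
Qed.

Lemma additive_eq0 (X : choiceType) (r : free_group X) (G : groupType) (x : X -> G)
    (V : zmodType) (C : G -> V) : presents r x ->
  {morph C : g h / g * h >-> (g + h)%R} -> (forall k, C (x k) = 0%R) ->
  forall g, C g = 0%R.
Proof.
move=> [sur _] CM Cx g; have [z <-] := sur g.
have C1 : C 1 = 0%R by apply: (@addrI _ (C 1)); rewrite -CM mulg1 addr0.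
elim/free_ind: z => [|k|a b IHa IHb|a IHa].
- by rewrite lift1.
- by rewrite lift_gen Cx.
- by rewrite liftM CM IHa IHb addr0.
- by rewrite gmulfV; apply: (@addIr _ (C (lift x a))); rewrite -CM mulVg C1 IHa addr0.
Qed.

Lemma presents_ind (X : choiceType) (r : free_group X) (G : groupType) (x : X -> G)
    (S : set G) : presents r x -> S 1 -> (forall a b, S a -> S b -> S (a * b)) ->
  (forall a, S a -> S a^-1) -> (forall k, S (x k)) -> forall g, S g.
Proof.
move=> [sur _] S1 SM SV Sx g; have [z <-] := sur g.
elim/free_ind: z => [|k|a b IHa IHb|a IHa].
- by rewrite lift1.
- by rewrite lift_gen.
- by rewrite liftM; apply: SM.
- by rewrite gmulfV; apply: SV.
Qed.

Section Orientable.
Variables (n : nat) (G : groupType) (x : 'I_n.+1.*2 -> G).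
Hypothesis rx : presents (orientable_relator n.+1) x.

Let F (i : nat) : free_group 'I_n.+1.*2 :=
  [~ free_gen (ord_dbl (inord i)), free_gen (ord_dblS (inord i))].

(** The loop [u, v] = u^-1 v^-1 u v starting at P reads the edges labelled u
    from P u^-1 and P u^-1 v^-1, and those labelled v from P u^-1 v^-1 and
    P u^-1 v^-1 u.  The generators are recovered from the p k / q k one handle
    at a time, the prefixes P i being known from the previous handles. *)
Lemma orientable_quadratic : quadratic (orientable_relator n.+1) x.
Proof.
pose P (i : nat) := lift x (\prod_(0 <= j < i) F j).
pose u i := x (ord_dbl i); pose v i := x (ord_dblS i).
pose h (k : 'I_n.+1.*2) := half_ord k.
pose p (k : 'I_n.+1.*2) := if odd k then P (h k) * (u (h k))^-1 * (v (h k))^-1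
            else P (h k) * (u (h k))^-1.
pose q (k : 'I_n.+1.*2) := if odd k then P (h k) * (u (h k))^-1 * (v (h k))^-1 * u (h k)
            else P (h k) * (u (h k))^-1 * (v (h k))^-1.
exists p, q; split=> [l g|S S1 SM SV Spq].
  rewrite {1}/orientable_relator prod_ord_nat -/F transport_prefix.
  rewrite big_mkord big_dbl hcen_sum; apply: eq_bigr => i _.
  rewrite -/(P i) /p /q odd_dbl odd_dblS /h half_dbl half_dblS /F inord_val.
  rewrite commgEl conjgE !(transportM, transportV) !gmulfV /= !lift_gen.
  rewrite !transport_gen !mulgA -/(u i) -/(v i).
  apply: heis_ext; rewrite ?(hxM, hyM, hzM, hxV, hyV, hzV) /hx /hy /hz /=;
    by rewrite ?opprF2; ring.
have main i : (i <= n.+1)%N -> S (P i) /\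
    forall j : 'I_n.+1, (j < i)%N -> S (u j) /\ S (v j).
  elim: i => [_|i IH lt_i].
    by split=> //; rewrite /P big_nil lift1.
  have [SP Suv] := IH (ltnW lt_i); pose i0 : 'I_n.+1 := inord i.
  have i0E : i0 = i :> nat by rewrite inordK.
  have SJ a : S (P i * a * (P i)^-1) -> S a.
    move=> Sa; have := SM _ _ (SM _ _ (SV _ SP) Sa) SP.
    by rewrite !mulgA mulVg mul1g mulgVK.
  have Suvu : S ((u i0)^-1 * v i0 * u i0).
    apply: SJ; have := Spq (ord_dbl i0).
    rewrite /p /q odd_dbl /h half_dbl i0E.
    by rewrite !invgM !invgK !mulgA.
  have Su : S (u i0).
    have Sw : S ((u i0)^-1 * (v i0)^-1 * (u i0)^-1 * v i0 * u i0).
      apply: SJ; have := Spq (ord_dblS i0).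
      rewrite /p /q odd_dblS /h half_dblS i0E.
      by rewrite !invgM !invgK !mulgA.
    rewrite -[u i0]invgK; apply: (SV).
    have := SM _ _ (SM _ _ Suvu Sw) (SV _ Suvu).
    by rewrite !invgM !invgK !mulgA !(mulgK, mulgVK).
  have Sv : S (v i0).
    by have := SM _ _ (SM _ _ Su Suvu) (SV _ Su); rewrite !mulgA mulgV mul1g mulgK.
  split.
    rewrite /P big_nat_recr //= liftM; apply: (SM) => //.
    rewrite gmulfR /= !lift_gen -/i0 -/(u i0) -/(v i0) commgEl conjgE.
    by do !apply: (SM) => //; apply: (SV).
  move=> j; rewrite ltnS leq_eqVlt => /orP [/eqP ji|]; last exact: Suv.
  by have -> : j = i0 by apply/val_inj; rewrite /= i0E.
apply: (presents_ind rx) => //; apply: dblP => i.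
  by have [_ /(_ i (ltn_ord i)) []] := main n.+1 (leqnn _).
by have [_ /(_ i (ltn_ord i)) []] := main n.+1 (leqnn _).
Qed.

Lemma orientable_coords : exists c : 'I_n.+1.*2 -> G -> int,
  (forall i, {morph c i : g h / g * h >-> (g + h)%R}) /\
  (forall i j, c i (x j) = (i == j)%:R%R).
Proof.
have ex i : exists ci : G -> int, {morph ci : g h / g * h >-> (g + h)%R} /\
    forall j, ci (x j) = (i == j)%:R%R.
  pose y j : heis int := ((i == j)%:R, 0, 0)%R.
  have [|f fE] := presents_hom (y := y) rx.
    by rewrite lift_orientable_heis big1 // => j _; rewrite /y /hx /hy /=; ring.
  exists (@hx _ \o f); split; first exact: hx_morph.
  by move=> j; rewrite /= -[x j](lift_gen x) fE lift_gen.
have [c cE] := choice ex.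
by exists c; split=> i; have [] := cE i.
Qed.

Lemma orientable_cup : cup_nonzero (orientable_relator n.+1)
  (fun k => (k == ord_dbl ord0)%:R%R) (fun k => (k == ord_dblS ord0)%:R%R).
Proof.
move=> y yx yy; rewrite lift_orientable_heis; congr hcen.
rewrite (bigD1 ord0) //= big1 => [|i /negbTE i0].
  by rewrite !yx !yy !eqxx dblS_dbl_eq addr0 mul0r subr0 mulr1.
by rewrite !yx !yy dbl_eq dblS_dbl_eq i0 !mul0r subrr.
Qed.

End Orientable.
(** With a = x_0 and t = x_1^-1 the relator says that t a t^-1 = a w^-1, where w
    is the product of the remaining commutators. *)
Lemma orientable_residually_finite k (G : groupType) (x : 'I_k.+1.*2 -> G) :
  presents (orientable_relator k.+1) x -> residually_finite G.
Proof.
move=> rx; pose J : finType := ('I_k * bool)%type.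
pose idx (j : J) : 'I_k.+1.*2 :=
  if j.2 then ord_dblS (fintype.lift ord0 j.1) else ord_dbl (fintype.lift ord0 j.1).
pose w : free_group J := \prod_(i < k)
  [~ free_gen ((i, false) : J), free_gen ((i, true) : J)].
have splitE (H : groupType) (y : 'I_k.+1.*2 -> H) :
    lift y (orientable_relator k.+1) =
    [~ y (ord_dbl ord0), y (ord_dblS ord0)] * lift (y \o idx) w.
  rewrite lift_orientable big_ord_recl gmulf_prod; congr (_ * _).
  by apply: eq_bigr => i _; rewrite gmulfR /= !lift_gen.
have relE (H : groupType) (y : 'I_k.+1.*2 -> H) :
    lift y (orientable_relator k.+1) = 1 <->
    hnn_rel 1 w^-1 true (y (ord_dblS ord0))^-1 (y (ord_dbl ord0)) (y \o idx).
  rewrite splitE /hnn_rel lift1 mul1g gmulfV /= invgK commgEl conjgE.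
  set a := y (ord_dbl _); set b := y (ord_dblS _); set W := lift _ w.
  split=> [e|e].
    by apply: (@mulgI _ a^-1); rewrite mulKg -[RHS]mul1g -e !mulgA mulgK.
  by rewrite !mulgA -(mulgA a^-1) -(mulgA a^-1) e mulKg mulVg.
apply: (hnn_residually_finite (t := (x (ord_dblS ord0))^-1) (a := x (ord_dbl ord0))
  (u := x \o idx) (P := 1) (Q := w^-1) (eps := true)).
- exact/relE/presents_rel.
- move=> S S1 SM SV St Sa Su; apply: (presents_ind rx) => //; apply: dblP => i.
    have [->|i0] := eqVneq i ord0; first exact: Sa.
    have [j ->|/eqP] := unliftP ord0 i; last by rewrite (negbTE i0).
    exact: (Su (j, false)).
  have [->|i0] := eqVneq i ord0; first by rewrite -[x _]invgK; apply: SV.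
  have [j ->|/eqP] := unliftP ord0 i; last by rewrite (negbTE i0).
  exact: (Su (j, true)).
move=> H t a u tau.
pose y (i : 'I_k.+1.*2) := if unlift ord0 (half_ord i) is Some j then u (j, odd i)
  else if odd i then t^-1 else a.
have y0 : y (ord_dbl ord0) = a by rewrite /y half_dbl unlift_none odd_dbl.
have y1 : y (ord_dblS ord0) = t^-1 by rewrite /y half_dblS unlift_none odd_dblS.
have yu : y \o idx = u.
  apply/funext => -[j b]; rewrite /y /idx /=.
  by case: b; rewrite ?half_dblS ?half_dbl liftK ?odd_dblS ?odd_dbl.
have [|f fE] := presents_hom (y := y) rx.
  by apply/relE; rewrite y0 y1 yu invgK.
have fx i : f (x i) = y i by rewrite -[x i](lift_gen x) fE lift_gen.
exists f; split; rewrite ?gmulfV ?fx ?y0 ?y1 ?invgK // => j.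
by rewrite -yu /= fx.
Qed.

Section OrientableTest.
Variables (k p : nat) (G : groupType) (x : 'I_k.+1.*2 -> G).
Hypotheses (k0 : (0 < k)%N) (p_pr : prime p) (p2 : (2 < p)%N).
Hypothesis rx : presents (orientable_relator k.+1) x.
Variable D : 'M['F_p]_k.+1.
Hypothesis eigD : forall c, ~~ eigenvalue D c /\ ~~ eigenvalue D^T%R c.

(** The alternating form that this element defines on Hom(G, F_p) is the
    symplectic form twisted by D acting on one Lagrangian summand and D^T on the
    other one. *)
Definition orientable_base : G := \prod_(i < k.+1) \prod_(j < k.+1)
  [~ x (ord_dbl i), x (ord_dblS j)] ^+ (D i j).

(** If al is the class killed by phi, the twisted form vanishes at (al, B)
    whenever the symplectic form does.  The two linear forms in B are thus
    proportional, so that the two halves of al are eigenvectors of D and D^T for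
    the same scalar, unless they vanish. *)
Lemma orientable_base_test g s m :
  (p ^ 2 %| s)%N -> coprime p m -> test_element (g ^+ s * orientable_base ^+ m).
Proof.
move=> p2s pm phi.
have ps : (p %| s)%N by rewrite (dvdn_trans _ p2s) // expnS dvdn_mulr.
set h := g ^+ s * _ => ph.
have [c [cM cx]] := orientable_coords rx.
apply: (bijective_of_mod_p rx (orientable_quadratic rx)
  (orientable_residually_finite rx) cM _ cx _ (cM (ord_dbl ord0)) (cM (ord_dblS ord0)) _ p_pr).
- by move=> V _ C CM Cx; exact: additive_eq0 rx CM Cx.
- by rewrite card_ord; lia.
- move=> y yx yy; apply: orientable_cup => i.
    by rewrite yx cx eq_sym; case: eqP.
  by rewrite yy cx eq_sym; case: eqP.
move=> al alphi.
have fh (B : 'I_k.+1.*2 -> 'F_p) :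
  (\sum_(i < k.+1) (al (ord_dbl i) * B (ord_dblS i) -
                    al (ord_dblS i) * B (ord_dbl i)) = 0)%R ->
  (\sum_(i < k.+1) \sum_(j < k.+1)
    (al (ord_dbl i) * B (ord_dblS j) - al (ord_dblS j) * B (ord_dbl i)) * D i j = 0)%R.
  move=> AB; pose y j : heis 'F_p := (al j, B j, 0)%R.
  have [|f fE] := presents_hom (y := y) rx.
    by rewrite lift_orientable_heis AB.
  have fx i : f (x i) = y i by rewrite -[x i](lift_gen x) fE lift_gen.
  have fA a : hx (f a) = (\sum_j al j * (c j a)%:~R)%R.
    apply/eqP; rewrite -subr_eq0; apply/eqP.
    apply: (additive_eq0 (C := fun a => hx (f a) - \sum_j al j * (c j a)%:~R)%R
      rx) => [a1 a2|i].
      rewrite gmulfM hxM; under eq_bigr do rewrite cM rmorphD mulrDr.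
      by rewrite big_split /=; ring.
    rewrite fx (bigD1 i) //= cx eqxx big1 => [|j ji].
      by rewrite /hx /=; ring.
    by rewrite cx (negbTE ji) mulr0.
  have f0 a : hx (f (phi a)) = 0%R by rewrite fA alphi.
  have fbase : f orientable_base = hcen (\sum_(i < k.+1) \sum_(j < k.+1)
    (al (ord_dbl i) * B (ord_dblS j) - al (ord_dblS j) * B (ord_dbl i)) * D i j)%R.
    rewrite gmulf_prod hcen_sum; apply: eq_bigr => i _.
    rewrite gmulf_prod hcen_sum; apply: eq_bigr => j _.
    rewrite gmulfXn gmulfR /= !fx heis_comm hcenX; congr hcen.
    by rewrite -mulr_natr natr_Zp.
  have fphibase : f (phi orientable_base) = 1.
    rewrite gmulf_prod gmulf_prod big1 // => i _; rewrite !gmulf_prod big1 // => j _.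
    by rewrite !gmulfXn !gmulfR heis_comm !f0 !mul0r subrr hcen0 expg1n.
  have : f h = 1.
    by rewrite -ph /h !gmulfM !gmulfXn fphibase expg1n mulg1 heis_expg_dvd.
  rewrite /h gmulfM gmulfXn heis_expg_dvd // mul1g gmulfXn fbase hcenX.
  move/(congr1 (@hz _)); rewrite /hz /= => /eqP.
  rewrite -mulr_natr mulf_eq0 => /orP [/eqP//|].
  by rewrite -(dvdn_pcharf (pchar_Fp p_pr)) => pm'; rewrite prime_coprime ?pm' in pm.
pose uu (i : 'I_k.+1.*2) : 'F_p :=
  if odd i then al (ord_dbl (half_ord i)) else (- al (ord_dblS (half_ord i)))%R.
pose vv (i : 'I_k.+1.*2) : 'F_p := if odd i
  then (\sum_i' al (ord_dbl i') * D i' (half_ord i))%R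
  else (- \sum_j al (ord_dblS j) * D (half_ord i) j)%R.
have uv B : (\sum_i uu i * B i = 0 -> \sum_i vv i * B i = 0)%R.
  rewrite !big_dbl => uB.
  have e0 : (\sum_(i < k.+1) (al (ord_dbl i) * B (ord_dblS i) -
      al (ord_dblS i) * B (ord_dbl i)) = 0)%R.
    rewrite -[RHS]uB; apply: eq_bigr => i _.
    by rewrite /uu odd_dbl odd_dblS half_dbl half_dblS; ring.
  rewrite -[RHS](fh B e0).
  rewrite big_split /=.
  have -> : (\sum_(i < k.+1) \sum_(j < k.+1)
      (al (ord_dbl i) * B (ord_dblS j) - al (ord_dblS j) * B (ord_dbl i)) * D i j =
    \sum_(i < k.+1) \sum_(j < k.+1) - (al (ord_dblS j) * D i j * B (ord_dbl i)) +
    \sum_(i < k.+1) \sum_(j < k.+1) al (ord_dbl i) * D i j * B (ord_dblS j))%R.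
    rewrite -big_split; apply: eq_bigr => i _.
    rewrite -big_split; apply: eq_bigr => j _.
    by rewrite /=; ring.
  congr (_ + _)%R.
    apply: eq_bigr => i _; rewrite /vv odd_dbl half_dbl sumrN mulNr; congr (- _)%R.
    by rewrite mulr_suml.
  rewrite [RHS]exchange_big /=; apply: eq_bigr => j _.
  by rewrite /vv odd_dblS half_dblS mulr_suml.
move=> j; apply: contrapT => /eqP alj.
have [|cc ccE] := proportional uv.
  move: alj; rewrite -(ord_dbl_half j); case: ifP => _ alj.
    by exists (ord_dbl (half_ord j)); rewrite /uu odd_dbl half_dbl oppr_eq0.
  by exists (ord_dblS (half_ord j)); rewrite /uu odd_dblS half_dblS.
have [Dc DTc] := eigD cc.
have al0 i : al (ord_dbl i) = 0%R.
  pose a : 'rV['F_p]_k.+1 := (\row_i al (ord_dbl i))%R.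
  have [a0|a0] := eqVneq a 0%R; first by have /rowP/(_ i) := a0; rewrite !mxE.
  case/eigenvalueP: Dc; exists a => //; apply/rowP => i'; rewrite !mxE.
  have := ccE (ord_dblS i'); rewrite /vv /uu odd_dblS half_dblS => <-.
  by apply: eq_bigr => j' _; rewrite mxE.
have al1 i : al (ord_dblS i) = 0%R.
  pose a : 'rV['F_p]_k.+1 := (\row_i al (ord_dblS i))%R.
  have [a0|a0] := eqVneq a 0%R; first by have /rowP/(_ i) := a0; rewrite !mxE.
  case/eigenvalueP: DTc; exists a => //; apply/rowP => i'; rewrite !mxE.
  have := ccE (ord_dbl i'); rewrite /vv /uu odd_dbl half_dbl mulrN => /oppr_inj <-.
  by apply: eq_bigr => j' _; rewrite !mxE.
by move: alj; rewrite -(ord_dbl_half j); case: ifP; rewrite ?al0 ?al1 eqxx.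
Qed.

End OrientableTest.
(** * Non-orientable surface groups *)

Lemma lift_nonorientable n (H : groupType) (y : 'I_n -> H) :
  lift y (nonorientable_relator n) = \prod_(i < n) y i ^+ 2.
Proof.
rewrite gmulf_prod; apply: eq_bigr => i _.
by rewrite gmulfXn /= lift_gen.
Qed.

Lemma ord_last_ind n (P : 'I_n.+1 -> Prop) :
  (forall i, P (widen_ord (leqnSn n) i)) -> P ord_max -> forall k, P k.
Proof.
move=> Pw Pm k; have [kn|kn] := ltnP k n.
  by have -> : k = widen_ord (leqnSn n) (Ordinal kn) by apply/val_inj.
have -> : k = ord_max; last by [].
by apply/val_inj/eqP; rewrite /= eqn_leq kn -ltnS ltn_ord.
Qed.

Lemma nonorientable_quadratic n (G : groupType) (x : 'I_n.+1 -> G) :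
  presents (nonorientable_relator n.+1) x ->
  quadratic (nonorientable_relator n.+1) x.
Proof.
move=> rx; pose F (i : nat) : free_group 'I_n.+1 := free_gen (inord i) ^+ 2.
pose P (i : nat) := lift x (\prod_(0 <= j < i) F j).
exists (fun i : 'I_n.+1 => P i), (fun i : 'I_n.+1 => P i * x i).
split=> [l g|S S1 SM SV Spq].
  rewrite {1}/nonorientable_relator prod_ord_nat -/F transport_prefix.
  rewrite big_mkord hcen_sum; apply: eq_bigr => i _.
  rewrite -/(P i) /F inord_val expg2 transportM !transport_gen lift_gen mulgA.
  by rewrite -hcenM.
have main i : (i <= n.+1)%N -> S (P i) /\ forall j : 'I_n.+1, (j < i)%N -> S (x j).
  elim: i => [_|i IH lt_i].
    by split=> //; rewrite /P big_nil lift1.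
  have [SP Sx] := IH (ltnW lt_i); pose i0 : 'I_n.+1 := inord i.
  have i0E : i0 = i :> nat by rewrite inordK.
  have Sx0 : S (x i0).
    have := SV _ (SM _ _ (SM _ _ (SV _ SP) (Spq i0)) SP).
    by rewrite i0E !invgM !invgK !mulgA !(mulgK, mulgVK) mulVg mul1g.
  split.
    rewrite /P big_nat_recr //= liftM; apply: (SM) => //.
    by rewrite gmulfXn /= lift_gen expg2; apply: (SM).
  move=> j; rewrite ltnS leq_eqVlt => /orP [/eqP ji|]; last exact: Sx.
  by have -> : j = i0 by apply/val_inj; rewrite /= i0E.
apply: (presents_ind rx) => // i.
by have [_ /(_ i (ltn_ord i))] := main n.+1 (leqnn _).
Qed.

(** The last generator is minus the sum of the others in H_1, up to 2-torsion. *)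
Lemma nonorientable_additive_eq0 n (G : groupType) (x : 'I_n.+1 -> G)
    (V : zmodType) (C : G -> V) :
  presents (nonorientable_relator n.+1) x -> (forall v : V, (v + v = 0 -> v = 0)%R) ->
  {morph C : g h / g * h >-> (g + h)%R} ->
  (forall i, C (x (widen_ord (leqnSn n) i)) = 0%R) -> forall g, C g = 0%R.
Proof.
move=> rx V2 CM Cx; apply: (additive_eq0 rx) => //; apply: ord_last_ind => //.
have C1 : C 1 = 0%R by apply: (@addrI _ (C 1)); rewrite -CM mulg1 addr0.
apply: V2; have := C1; rewrite -(presents_rel rx) lift_nonorientable.
rewrite (big_morph C CM C1) big_ord_recr /= expg2 CM big1 ?add0r // => i _.
by rewrite expg2 CM Cx addr0.
Qed.

Lemma heis_abelian_prod (R : comNzRingType) I (s : seq I) (a : I -> R) :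
  \prod_(i <- s) ((a i, 0, 0)%R : heis R) = (\sum_(i <- s) a i, 0, 0)%R.
Proof.
elim: s => [|i s IH]; first by rewrite !big_nil.
by rewrite !big_cons IH; apply: heis_ext; rewrite ?(hxM, hyM, hzM) /hx /hy /hz /=; ring.
Qed.

Lemma nonorientable_coords n (G : groupType) (x : 'I_n.+1 -> G) :
  presents (nonorientable_relator n.+1) x -> exists c : 'I_n -> G -> int,
  [/\ forall i, {morph c i : g h / g * h >-> (g + h)%R},
      forall i j, c i (x (widen_ord (leqnSn n) j)) = (i == j)%:R%R &
      forall i, c i (x ord_max) = (- 1)%R].
Proof.
move=> rx.
have ex i : exists ci : G -> int, [/\ {morph ci : g h / g * h >-> (g + h)%R},
    forall j, ci (x (widen_ord (leqnSn n) j)) = (i == j)%:R%R &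
    ci (x ord_max) = (- 1)%R].
  pose a (j : 'I_n.+1) : int := (if j == ord_max then - 1 else (val j == val i)%:R)%R.
  have am : a ord_max = (- 1)%R by rewrite /a eqxx.
  have aw j : a (widen_ord (leqnSn n) j) = (i == j)%:R%R.
    by rewrite /a -!val_eqE /= ltn_eqF // eq_sym.
  have [|f fE] := presents_hom (y := fun j => (a j, 0, 0)%R : heis int) rx.
    rewrite lift_nonorientable.
    under eq_bigr => j _.
      have -> : ((a j, 0, 0)%R : heis int) ^+ 2 = ((a j + a j, 0, 0)%R : heis int).
        rewrite expg2; apply: heis_ext; rewrite ?(hxM, hyM, hzM);
          by rewrite /hx /hy /hz /=; ring.
      over.
    rewrite heis_abelian_prod; apply: heis_ext => //; rewrite /hx /=.
    rewrite big_split /= big_ord_recr /= am (bigD1 i) //= big1 => [|j ji].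
      by rewrite aw eqxx.
    by rewrite aw eq_sym (negbTE ji).
  have fx j : hx (f (x j)) = a j by rewrite -[x j](lift_gen x) fE lift_gen.
  exists (@hx _ \o f); split; first exact: hx_morph.
    by move=> j; rewrite /= fx aw.
  by rewrite /= fx am.
have [c cE] := choice ex.
by exists c; split=> i; have [] := cE i.
Qed.

Lemma nonorientable_cup n (A B : 'I_n -> 'F_2) : (\sum_i A i * B i = 1)%R ->
  cup_nonzero (nonorientable_relator n) A B.
Proof.
move=> AB y yx yy; rewrite lift_nonorientable -AB hcen_sum; apply: eq_bigr => i _.
rewrite expg2; apply: heis_ext; rewrite ?(hxM, hyM, hzM) ?addF2 // yx yy.
by rewrite add0r.
Qed.

(** For odd p there is no obstruction to lifting a pair of classes: the relator
    evaluates to a central element, which is cancelled by multiplying one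
    generator by a central square root of its inverse. *)
Lemma nonorientable_heis n (p : nat) (G : groupType) (x : 'I_n.+1 -> G)
    (A B : 'I_n.+1 -> 'F_p) :
  prime p -> (2 < p)%N -> presents (nonorientable_relator n.+1) x ->
  (\sum_i A i = 0)%R -> (\sum_i B i = 0)%R ->
  exists f : UMagmaMorphism.type G (heis 'F_p),
    forall i, hx (f (x i)) = A i /\ hy (f (x i)) = B i.
Proof.
move=> p_pr p2 rx A0 B0.
pose y i : heis 'F_p := (A i, B i, 0)%R.
pose T := lift y (nonorientable_relator n.+1).
have TE : T = hcen (hz T).
  rewrite /T lift_nonorientable; apply: heis_ext => //.
    rewrite hx_prod; under eq_bigr do rewrite hxX.
    by rewrite sumrMnl A0 mul0rn.
  rewrite hy_prod; under eq_bigr do rewrite hyX.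
  by rewrite sumrMnl B0 mul0rn.
pose y' i := if i == ord0 then hcen (- (hz T / 2%:R))%R * y i else y i.
have [|f fE] := presents_hom (y := y') rx.
  rewrite lift_nonorientable big_ord_recl /y' eqxx expgMn; last exact: hcenC.
  rewrite hcenX.
  have -> : (- (hz T / 2%:R) *+ 2 = - hz T)%R.
    rewrite mulNrn -(mulr_natr (hz T / 2%:R)%R 2) divfK //.
    by rewrite -(dvdn_pcharf (pchar_Fp p_pr)) gtnNdvd.
  apply: (@mulgI _ (hcen (hz T))); rewrite mulg1 !mulgA -hcenM subrr mul1g -TE.
  by rewrite /T lift_nonorientable big_ord_recl.
exists f => i; rewrite -[x i](lift_gen x) fE lift_gen /y'; case: eqP => // _.
by rewrite hxM hyM /hx /hy /= !add0r.
Qed.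

(** With t = x_0 and a = x_0 x_1 the relator x_0^2 x_1^2 w says that
    t a t^-1 = w^-1 a^-1. *)
Lemma nonorientable_residually_finite k (G : groupType) (x : 'I_k.+2 -> G) :
  presents (nonorientable_relator k.+2) x -> residually_finite G.
Proof.
move=> rx.
pose idx (j : 'I_k) : 'I_k.+2 := fintype.lift ord0 (fintype.lift ord0 j).
pose w : free_group 'I_k := \prod_(i < k) free_gen i ^+ 2.
pose o1 : 'I_k.+2 := fintype.lift ord0 ord0.
have splitE (H : groupType) (y : 'I_k.+2 -> H) :
    lift y (nonorientable_relator k.+2) =
    y ord0 ^+ 2 * (y o1 ^+ 2 * lift (y \o idx) w).
  rewrite lift_nonorientable !big_ord_recl gmulf_prod; congr (_ * (_ * _)).
  by apply: eq_bigr => i _; rewrite gmulfXn /= !lift_gen.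
have relE (H : groupType) (y : 'I_k.+2 -> H) :
    lift y (nonorientable_relator k.+2) = 1 <->
    hnn_rel w^-1 1 false (y ord0) (y ord0 * y o1) (y \o idx).
  rewrite splitE /hnn_rel lift1 mulg1 gmulfV /= !expg2 invgM.
  set a := y ord0; set b := y o1; set W := lift _ w.
  split=> [e|e].
    apply: (@mulgI _ W); rewrite mulVKg.
    apply: (@mulgI _ (a * a * (b * b))).
    by rewrite !mulgA in e *; rewrite e mul1g !mulgK.
  apply/eqP; rewrite mulgA mulg_eq1; apply/eqP.
  apply: (@mulIg _ (b^-1 * a^-1)); rewrite -e.
  by rewrite !mulgA mulgK.
apply: (hnn_residually_finite (t := x ord0) (a := x ord0 * x o1)
  (u := x \o idx) (P := w^-1) (Q := 1) (eps := false)).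
- exact/relE/presents_rel.
- move=> S S1 SM SV St Sa Su; apply: (presents_ind rx) => // i.
  have [->|i0] := eqVneq i ord0; first exact: St.
  have [j ->|/eqP] := unliftP ord0 i; last by rewrite (negbTE i0).
  have [->|j0] := eqVneq j ord0.
    by have := SM _ _ (SV _ St) Sa; rewrite mulKg.
  have [j' ->|/eqP] := unliftP ord0 j; last by rewrite (negbTE j0).
  exact: (Su j').
move=> H t a u tau.
pose y (i : 'I_k.+2) := if unlift ord0 i is Some j then
  (if unlift ord0 j is Some j' then u j' else t^-1 * a) else t.
have y0 : y ord0 = t by rewrite /y unlift_none.
have y1 : y o1 = t^-1 * a by rewrite /y liftK unlift_none.
have yu : y \o idx = u by apply/funext => j; rewrite /y /idx /= !liftK.
have [|f fE] := presents_hom (y := y) rx.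
  by apply/relE; rewrite y0 y1 yu mulVKg.
have fx i : f (x i) = y i by rewrite -[x i](lift_gen x) fE lift_gen.
exists f; split; rewrite ?gmulfM ?fx ?y0 ?y1 ?mulVKg // => j.
by rewrite -yu /= fx.
Qed.
Section NonorientableTest.
Variables (k p : nat) (G : groupType) (x : 'I_k.+3 -> G).
Hypotheses (p_pr : prime p) (p2 : (2 < p)%N).
Hypothesis rx : presents (nonorientable_relator k.+3) x.

(** The chain of commutators gives an alternating form whose radical has
    dimension at most 1, depending on parity; the p-th power of x_0 is there to
    detect that radical.  The last generator is left out, the others being a
    basis of H_1 modulo torsion. *)
Definition nonorientable_base : G :=
  x ord0 ^+ p * \prod_(i < k.+1) [~ x (inord i), x (inord i.+1)].

(** Evaluating an integral lift C of the class on both sides of phi(h) = h and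
    reducing modulo p^2 shows that the coefficient at x_0 is divisible by p.  The
    Heisenberg representations then give the two-step recursion
    al (j+1) = al (j-1), which propagates the vanishing. *)
Lemma nonorientable_base_test g s m :
  (p ^ 2 %| s)%N -> coprime p m -> test_element (g ^+ s * nonorientable_base ^+ m).
Proof.
move=> p2s pm phi.
have ps : (p %| s)%N by rewrite (dvdn_trans _ p2s) // expnS dvdn_mulr.
have m0 : (m%:R != 0 :> 'F_p)%R.
  by rewrite -(dvdn_pcharf (pchar_Fp p_pr)) -prime_coprime.
set h := g ^+ s * _ => ph.
have [c [cM cx cl]] := nonorientable_coords rx.
pose em (i : 'I_k.+2) : 'I_k.+3 := widen_ord (leqnSn k.+2) i.
pose o1 : 'I_k.+2 := fintype.lift ord0 ord0.
have e01 : (ord0 == o1) = false by [].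
apply: (bijective_of_mod_p (e := fun i => x (em i)) (c := c)
  (A := fun g => (c ord0 g - c o1 g)%R) (B := c o1) rx
  (nonorientable_quadratic rx) (nonorientable_residually_finite rx)
  cM _ _ _ _ (cM o1) _ p_pr) => //.
- by move=> V V2 C CM Cx; apply: (nonorientable_additive_eq0 rx).
- by rewrite card_ord; lia.
- by move=> a b; rewrite !cM; ring.
- apply: nonorientable_cup; rewrite big_ord_recr /= (bigD1 o1) //= big1 => [|i io].
    by rewrite !cx !cl eqxx e01; apply/val_inj.
  by rewrite !cx [o1 == i]eq_sym (negbTE io) mulr0.
move=> al alphi.
pose A a : 'F_p := (\sum_j al j * (c j a)%:~R)%R.
have AM : {morph A : a b / a * b >-> (a + b)%R}.
  move=> a b; rewrite /A; under eq_bigr do rewrite cM rmorphD mulrDr.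
  by rewrite big_split.
have Ax j : A (x (em j)) = al j.
  rewrite /A (bigD1 j) //= cx eqxx mulr1 big1 ?addr0 // => i ij.
  by rewrite cx (negbTE ij) mulr0.
have Al : A (x ord_max) = (- \sum_j al j)%R.
  by rewrite /A -sumrN; apply: eq_bigr => j _; rewrite cl mulrN1.
have Asum : (\sum_i A (x i) = 0)%R.
  by rewrite big_ord_recr /= Al; under eq_bigr do rewrite Ax; rewrite subrr.
have al0 : al ord0 = 0%R.
  pose C a : int := (\sum_j (val (al j))%:Z * c j a)%R.
  have CM : {morph C : a b / a * b >-> (a + b)%R}.
    move=> a b; rewrite /C; under eq_bigr do rewrite cM mulrDr.
    by rewrite big_split.
  have CA a : ((C a)%:~R = A a)%R.
    rewrite /C rmorph_sum; apply: eq_bigr => j _.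
    by rewrite rmorphM /=; congr (_ * _)%R; rewrite -[RHS]natr_Zp.
  have C1 : C 1 = 0%R by apply: (@addrI _ (C 1)); rewrite -CM mulg1 addr0.
  have CV a : C a^-1 = (- C a)%R by apply/eqP; rewrite -addr_eq0 -CM mulVg C1.
  have CX a i : C (a ^+ i) = (C a * i%:Z)%R.
    by elim: i => [|i IH]; rewrite ?mulr0 // expgS CM IH intS mulrDr mulr1.
  have Cbase (u : 'I_k.+3 -> G) :
      C (u ord0 ^+ p * \prod_(i < k.+1) [~ u (inord i), u (inord i.+1)]) =
      (C (u ord0) * p%:Z)%R.
    rewrite CM CX (big_morph C CM C1) big1 ?addr0 // => i _.
    by rewrite commgEl conjgE !CM !CV; ring.
  have := congr1 C ph; rewrite /h gmulfM !gmulfXn !CM !CX /nonorientable_base.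
  rewrite gmulfM gmulfXn gmulf_prod; under eq_bigr do rewrite gmulfR.
  rewrite (Cbase x) (Cbase (phi \o x)) /=.
  have /dvdzP [t ->] : (p %| C (phi (x ord0)))%Z.
    by rewrite (dvdz_pcharf (pchar_Fp p_pr)) CA; apply/eqP; exact: alphi.
  case/dvdnP: p2s => q ->; rewrite PoszM => e.
  have p0 : (p%:Z != 0)%R by rewrite eqz_nat -lt0n prime_gt0.
  have : (C (x ord0) * m%:Z = (C (phi g) * q%:Z - C g * q%:Z + t * m%:Z) * p%:Z)%R.
    apply: (mulIf p0); move: e; rewrite expnS expn1 PoszM => e.
    rewrite mulrAC -[LHS](addKr (C g * (q%:Z * (p%:Z * p%:Z)))%R) -e; ring.
  move/(congr1 (fun z : int => z%:~R%R : 'F_p)).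
  rewrite !rmorphM /= CA.
  have -> : x ord0 = x (em ord0) by congr x; apply/val_inj.
  rewrite Ax; have -> : (p%:~R = 0 :> 'F_p)%R.
    by apply/eqP; rewrite -[_ == _](dvdz_pcharf (pchar_Fp p_pr)) dvdzz.
  by rewrite mulr0 => /eqP; rewrite mulf_eq0 -pmulrn (negbTE m0) orbF => /eqP.
have chain (B : 'I_k.+2 -> 'F_p) : (\sum_(i < k.+1)
    (al (inord i) * B (inord i.+1) - al (inord i.+1) * B (inord i)) = 0)%R.
  pose B' (i : 'I_k.+3) : 'F_p :=
    if i == ord_max then (- \sum_j B j)%R else B (inord i).
  have Bem i : B' (em i) = B i.
    by rewrite /B' -val_eqE /= ltn_eqF //; congr B; apply/val_inj; rewrite /= inordK.
  have B0 : (\sum_i B' i = 0)%R.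
    rewrite big_ord_recr /= [B' ord_max]/B' eqxx; under eq_bigr do rewrite Bem.
    by rewrite subrr.
  have [f fAB] := nonorientable_heis p_pr p2 rx Asum B0.
  have fA a : hx (f a) = A a.
    apply/eqP; rewrite -subr_eq0; apply/eqP.
    apply: (additive_eq0 (C := fun a => (hx (f a) - A a)%R) rx) => [a1 a2|i].
      by rewrite gmulfM hxM AM; ring.
    by rewrite (fAB i).1 subrr.
  have f0 a : hx (f (phi a)) = 0%R by rewrite fA /A alphi.
  have inE' (i : nat) : (i < k.+2)%N -> (inord i : 'I_k.+3) = em (inord i).
    by move=> ik; apply/val_inj; rewrite /= !inordK // ltnW.
  have fbase : f nonorientable_base = hcen (\sum_(i < k.+1)
      (al (inord i) * B (inord i.+1) - al (inord i.+1) * B (inord i)))%R.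
    rewrite gmulfM gmulfXn heis_expg_dvd // mul1g gmulf_prod hcen_sum.
    apply: eq_bigr => i _; rewrite gmulfR heis_comm !(fAB _).1 !(fAB _).2.
    by rewrite !inE' ?Ax ?Bem //; [have := ltn_ord i; lia .. ].
  have fphibase : f (phi nonorientable_base) = 1.
    rewrite !gmulfM !gmulfXn heis_expg_dvd // mul1g !gmulf_prod big1 // => i _.
    by rewrite !gmulfR heis_comm !f0 !mul0r subrr.
  have : f h = 1.
    by rewrite -ph /h !gmulfM !gmulfXn fphibase expg1n mulg1 heis_expg_dvd.
  rewrite /h gmulfM gmulfXn heis_expg_dvd // mul1g gmulfXn fbase hcenX.
  move/(congr1 (@hz _)); rewrite /hz /= => /eqP.
  by rewrite -mulr_natr mulf_eq0 (negbTE m0) orbF => /eqP.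
have step j : (j < k.+1)%N ->
    al (inord j.+1) = (if j is j'.+1 then al (inord j') else 0)%R.
  move=> jk; have jE : (inord j : 'I_k.+2) = j :> nat by rewrite inordK // ltnW.
  have := chain (fun i => (i == inord j)%:R%R); rewrite sumrB.
  rewrite [X in (_ - X)%R](bigD1 (Ordinal jk)) //= eqxx mulr1.
  rewrite [X in (_ - (_ + X))%R]big1 ?addr0 => [|i ij]; last first.
    have ijn : (i == j :> nat) = false by apply: negbTE.
    by rewrite -val_eqE /= jE inordK ?ijn ?mulr0 // ltnW // ltnS.
  move/subr0_eq => <-.
  case: j jk jE => [|j] jk jE.
    rewrite big1 // => i _; rewrite -val_eqE /= jE inordK ?mulr0 //.
    by rewrite ltnS.
  rewrite (bigD1 (Ordinal (ltnW jk))) //= eqxx mulr1 big1 ?addr0 // => i ij.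
  have ijn : (i == j :> nat) = false by apply: negbTE.
  by rewrite -val_eqE /= jE inordK ?eqSS ?ijn ?mulr0 // ltnS.
have main j : (j < k.+1)%N -> al (inord j) = 0%R /\ al (inord j.+1) = 0%R.
  elim: j => [|j IH] jk.
    by rewrite step // (_ : inord 0 = ord0) //; apply/val_inj; rewrite /= inordK.
  have [a0 a1] := IH (ltnW jk); split=> //.
  by rewrite step.
move=> j; rewrite -[j]inord_val; case: (nat_of_ord j) (ltn_ord j) => [|j'] jk.
  by have [] := main 0 isT.
by have [] := main j' jk.
Qed.
End NonorientableTest.
Theorem theorem5 (G : groupType) (n : nat) :
  (2 <= n)%N /\ orientable_surface_group n G \/
  (3 <= n)%N /\ nonorientable_surface_group n G ->
  dense ([set g : G | test_element g]
    : set (profinite G)).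
Proof.
move=> GS; apply: dense_test_elements => p p_pr p2.
case: GS => -[n2 /isomorphic_presents [x rx]].
  case: n n2 x rx => [|[|k]] // _ x rx.
  have [D eigD] := @eigenvalue_free 'F_p k.+2 isT.
  by exists (orientable_base x D) => g s m; apply: orientable_base_test.
case: n n2 x rx => [|[|[|k]]] // _ x rx.
by exists (nonorientable_base p x) => g s m; apply: nonorientable_base_test.
Qed.
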